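(* Let $K=(\mathcal V,\mathcal E)$ be a connected, locally finite graph with weights $c$ on vertices and $r$ on edges. If $K$ is $\chi$-complete and the closure $\bar D$ of its (essentially self-adjoint) Gauß-Bonnet operator $D=d+\delta$ is positive at infinity, then $\operatorname{Im}(\bar D)$ is closed and, as a consequence, the Hodge property holds: $$L_2(\mathcal E)=\operatorname{Ker}\bar\delta\oplus\operatorname{Im}(\bar d),\qquad L_2(\mathcal V)=\operatorname{Ker}\bar d\oplus\operatorname{Im}(\bar\delta).$$
   Context: A graph $K=(\mathcal V,\mathcal E)$ consists of a set $\mathcal V$ of vertices and a set $\mathcal E\subset\mathcal V\times\mathcal V$ of oriented edges, which is symmetric ($(v_1,v_2)\in\mathcal E\Rightarrow(v_2,v_1)\in\mathcal E$) and without loops. For $e=(v_1,v_2)\in\mathcal E$ put $e^-=v_1$, $e^+=v_2$, $-e=(v_2,v_1)$. $K$ is connected if any two vertices are joined by a finite path of edges, and locally finite if each vertex belongs to finitely many edges. Weights: $c:\mathcal V\to(0,\infty)$ and $r:\mathcal E\to(0,\infty)$ with $r(-e)=r(e)$. $C^0(K)=\mathbb C^{\mathcal V}$; $C^1(K)=\{\varphi:\mathcal E\to\mathbb C:\ \varphi(-e)=-\varphi(e)\}$; $C_0^0(K)$, $C_0^1(K)$ are the subspaces of finitely supported elements. Inner products: $\langle f,g\rangle=\sum_{v\in\mathcal V}c(v)f(v)\overline{g(v)}$ and $\langle\varphi,\psi\rangle=\frac12\sum_{e\in\mathcal E}r(e)\varphi(e)\overline{\psi(e)}$; $L_2(\mathcal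 V)$, $L_2(\mathcal E)$ are the Hilbert spaces of elements of $C^0(K)$, $C^1(K)$ of finite norm, and $\mathcal H=L_2(\mathcal V)\oplus L_2(\mathcal E)$ with $\|(f,\varphi)\|^2=\|f\|^2+\|\varphi\|^2$. Operators: $d f(e)=f(e^+)-f(e^-)$ on $C_0^0(K)$, $\delta\varphi(x)=\frac{1}{c(x)}\sum_{e\in\mathcal E,\,e^+=x}r(e)\varphi(e)$ on $C_0^1(K)$, $D(f,\varphi)=(\delta\varphi,df)$ on $C_0^0(K)\oplus C_0^1(K)$. $\bar d,\bar\delta,\bar D$ denote the closures of these operators in the $L_2$ spaces. Direct sums are orthogonal. $K$ is $\chi$-complete if there is an increasing sequence of finite sets $(B_n)_{n\in\mathbb N}$ with $\mathcal V=\bigcup_n B_n$ and functions $\chi_n$ such that: (i) $\chi_n\in C_0^0(K)$, $0\le\chi_n\le1$; (ii) $v\in B_n\Rightarrow\chi_n(v)=1$; (iii) there is $C>0$ such that for all $n\in\mathbb N$ and $x\in\mathcal V$, $\frac{1}{c(x)}\sum_{e:\ e^+=x\text{ or }e^-=x}r(e)\,(d\chi_n(e))^2\le C$. A subgraph of $K$ is a graph $K_0=(\mathcal V_0,\mathcal E_0)$ with $\mathcal V_0\subset\mathcal V$, $\mathcal E_0\subset\mathcal E$. Its complementary graph is $K_0^c=(\mathcal V^c,\mathcal E^c)$ with $\mathcal V^c=\mathcal V\setminus\mathcal V_0$ and $\mathcal E^c=\{e\in\mathcal E\setminus\mathcal E_0:\ e^+,e^-\in\mathcal V^c\}$. $\bar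 D$ is positive at infinity if there exist a finite connected subgraph $K_0$ of $K$ and $C>0$ such that for all $(f,\varphi)\in\big(L_2(\mathcal V^c)\times L_2(\mathcal E^c)\big)\cap\operatorname{Dom}(\bar D)$ one has $\|(f,\varphi)\|\le C\|\bar D(f,\varphi)\|$, where elements of $L_2(\mathcal V^c)\times L_2(\mathcal E^c)$ are identified with their extensions by $0$ to $\mathcal V$ and $\mathcal E$. *)

(* Defs.v *)
(* MathComp + MathComp-Analysis *)
From HB Require Import structures.
From mathcomp Require Import all_boot all_order all_algebra.
From mathcomp Require Export complex.
From mathcomp Require Export all_classical all_reals all_analysis.
Set Implicit Arguments.
Unset Strict Implicit.
Unset Printing Implicit Defensive.
Import Order.TTheory GRing.Theory Num.Theory.
Import numFieldNormedType.Exports.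
Local Open Scope classical_set_scope.
Local Open Scope ring_scope.

(* The vertex set is a subset of an ambient carrier type V, so that a graph,
   its subgraphs and their complementary graphs are objects of one type. *)
Record graph (V : choiceType) := Graph {
  vertices : set V;
  edges : set (V * V);
  edges_vertices : edges `<=` vertices `*` vertices;
  edges_sym : forall x y, edges (x, y) -> edges (y, x);
  edges_loopless : forall x, ~ edges (x, x) }.

Section Graphs.
Variable V : choiceType.
Implicit Types (K : graph V) (e : V * V).

(* e = (e^-, e^+); opp_edge e is -e. *)
Definition opp_edge e : V * V := (e.2, e.1).

Definition connected_graph K := forall x y, vertices K x -> vertices K y ->
  exists p : seq V, path.path (fun u v => (u, v) \in edges K) x p /\ last x p = y.

Definition locally_finite K := forall x, vertices K x ->
  finite_set [set e | edges K e /\ (e.2 = x \/ e.1 = x)].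

Definition finite_graph K := finite_set (vertices K) /\ finite_set (edges K).

Definition subgraph K0 K :=
  vertices K0 `<=` vertices K /\ edges K0 `<=` edges K.

Section Complement.
Variables K K0 : graph V.

Definition compl_vertices := vertices K `\` vertices K0.

Definition compl_edges := [set e | (edges K `\` edges K0) e /\
  (compl_vertices e.2 /\ compl_vertices e.1)].

Lemma compl_edges_vertices :
  compl_edges `<=` compl_vertices `*` compl_vertices.
Proof. by move=> e [_ [? ?]]. Qed.

Lemma compl_edges_sym x y : compl_edges (x, y) -> compl_edges (y, x).
Proof.
move=> [[Kxy nK0xy] [Vy Vx]]; split; last by [].
by split; [exact: edges_sym|move=> /edges_sym].
Qed.

Lemma compl_edges_loopless x : ~ compl_edges (x, x).
Proof. by move=> [[/edges_loopless]]. Qed.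

Definition complementary_graph : graph V :=
  Graph compl_edges_vertices compl_edges_sym compl_edges_loopless.

End Complement.
End Graphs.

Definition weights (R : realType) (V : choiceType) (K : graph V)
    (c : V -> R) (r : V * V -> R) :=
  [/\ forall v, vertices K v -> 0 < c v,
      forall e, edges K e -> 0 < r e &
      forall e, edges K e -> r (opp_edge e) = r e].

Section Sums.
Variables (R : realType) (T : choiceType).

(* Sum of an absolutely summable real, resp. complex, family indexed by S
   (esum is the sum of a family with values in [0, +oo]). *)
Definition real_sum (S : set T) (F : T -> R) : R :=
  fine (\esum_(t in S) (EFin \o F)^\+%E t) -
  fine (\esum_(t in S) (EFin \o F)^\-%E t).

Definition complex_sum (S : set T) (F : T -> R[i]) : R[i] :=
  (real_sum S (fun t => complex.Re (F t)) +i*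
   real_sum S (fun t => complex.Im (F t)))%C.

End Sums.

(* Norms take values in \bar R and are +oo on elements of infinite norm. *)
Section Closures.
Variable R : realType.

Definition pair_norm (X Y : Type) (N : X -> \bar R) (M : Y -> \bar R)
    (z : X * Y) : \bar R :=
  sqrte (N z.1 ^+ 2 + M z.2 ^+ 2)%E.

(* Closure of A in the normed space (L, N), N being a norm on L only. *)
Definition norm_closure (X : zmodType) (L : set X) (N : X -> \bar R)
    (A : set X) : set X :=
  [set x | L x /\ exists u : nat -> X,
    (forall n, A (u n)) /\ (N (u n - x) @[n --> \oo] --> 0%E)].

Definition norm_closed (X : zmodType) (L : set X) (N : X -> \bar R)
    (A : set X) :=
  norm_closure L N A `<=` A.

(* An operator is identified with its graph, the set of pairs (x, A x); its
   domain and image are A.`1 and A.`2, and its closure is the operator whose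
   graph is the closure of the graph of A in L `*` M. *)
Definition op_closure (X Y : zmodType) (L : set X) (N : X -> \bar R)
    (M : set Y) (P : Y -> \bar R) (A : set (X * Y)) : set (X * Y) :=
  norm_closure (L `*` M) (pair_norm N P) A.

End Closures.

Definition op_ker (X Y : zmodType) (A : set (X * Y)) : set X :=
  [set x | A (x, 0)].

Definition orthogonal_sum (C X : zmodType) (inner : X -> X -> C)
    (L A B : set X) :=
  L = [set a + b | a in A & b in B] /\
  forall a b, A a -> B b -> inner a b = 0.

Section Cochains.
Variables (R : realType) (V : choiceType).
Variables (K : graph V) (c : V -> R) (r : V * V -> R).

(* Functions on the vertices (resp. edges) of K are represented by their
   extension by 0 to V (resp. V * V). *)
Definition C0 : set (V -> R[i]) :=
  [set f | forall v, ~ vertices K v -> f v = 0].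

Definition C1 : set (V * V -> R[i]) :=
  [set phi | (forall e, ~ edges K e -> phi e = 0) /\
             forall e, edges K e -> phi (opp_edge e) = - phi e].

Definition C00 := [set f | C0 f /\ finite_set [set v | f v != 0]].

Definition C01 := [set phi | C1 phi /\ finite_set [set e | phi e != 0]].

Definition innerV (f g : V -> R[i]) : R[i] :=
  complex_sum (vertices K) (fun v => (c v)%:C%C * f v * (g v)^*).

Definition innerE (phi psi : V * V -> R[i]) : R[i] :=
  2^-1 * complex_sum (edges K) (fun e => (r e)%:C%C * phi e * (psi e)^*).

Definition normV (f : V -> R[i]) : \bar R :=
  sqrte (\esum_(v in vertices K) (c v * (Normc.normc (f v)) ^+ 2)%:E).

Definition normE (phi : V * V -> R[i]) : \bar R :=
  sqrte ((2^-1)%:E *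
    \esum_(e in edges K) (r e * (Normc.normc (phi e)) ^+ 2)%:E)%E.

Definition L2V := [set f | C0 f /\ (normV f < +oo)%E].

Definition L2E := [set phi | C1 phi /\ (normE phi < +oo)%E].

Definition L2H := L2V `*` L2E.

Definition normH := pair_norm normV normE.

Definition dK (f : V -> R[i]) : V * V -> R[i] :=
  fun e => if e \in edges K then f e.2 - f e.1 else 0.

Definition deltaK (phi : V * V -> R[i]) : V -> R[i] :=
  fun x => ((c x)%:C%C)^-1 *
    \sum_(e \in [set e | edges K e /\ e.2 = x]) (r e)%:C%C * phi e.

Definition d_op := [set (f, dK f) | f in C00].

Definition delta_op := [set (phi, deltaK phi) | phi in C01].

Definition D_op := [set (h, (deltaK h.2, dK h.1)) | h in C00 `*` C01].

Definition d_bar := op_closure L2V normV L2E normE d_op.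

Definition delta_bar := op_closure L2E normE L2V normV delta_op.

Definition D_bar := op_closure L2H normH L2H normH D_op.

(* "0 <= chi n v <= 1" is for the partial order of R[i], so it forces chi n v
   to be real; the same holds for the upper bound by C. *)
Definition chi_complete :=
  exists (B : nat -> set V) (chi : nat -> V -> R[i]),
    [/\ forall n, finite_set (B n), forall n, B n `<=` B n.+1 &
        \bigcup_n B n = vertices K] /\
    [/\ forall n, C00 (chi n) /\
          forall v, vertices K v -> 0 <= chi n v <= 1,
        forall n v, B n v -> chi n v = 1 &
        exists C : R, 0 < C /\ forall n x, vertices K x ->
          ((c x)%:C%C)^-1 *
            \sum_(e \in [set e | edges K e /\ (e.2 = x \/ e.1 = x)])
               (r e)%:C%C * dK (chi n) e ^+ 2
          <= C%:C%C].

End Cochains.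

Definition positive_at_infinity (R : realType) (V : choiceType) (K : graph V)
    (c : V -> R) (r : V * V -> R) :=
  exists K0 : graph V,
    [/\ subgraph K0 K, finite_graph K0 & connected_graph K0] /\
    exists C : R, 0 < C /\
      forall h k : (V -> R[i]) * (V * V -> R[i]),
        L2H (complementary_graph K K0) c r h -> D_bar K c r (h, k) ->
        (normH K c r h <= C%:E * normH K c r k)%E.

(* Main.v *)
(* The graph of the closure of D is, up to the order of the factors, the product
   of the graphs of the closures of d and delta, so it suffices to treat d and
   delta separately.

   Closed range.  Outside the finite set of vertices of K0, and of edges of K
   that are not edges of the complementary graph, the operator is bounded below,
   hence has closed range there.  The remaining coordinates span a
   finite-dimensional space of finitely supported elements of the domain, and
   adding finitely many lines to a closed subspace keeps it closed.

   Hodge decomposition.  By the projection theorem an element splits into a part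
   in the closed range of d (resp. delta) and a part psi orthogonal to it;
   testing against indicators of vertices (resp. edges) gives delta psi = 0
   (resp. d psi = 0) pointwise.  Multiplying psi by the cut-off functions chi_n
   (averaged over the end points of an edge in the case of 1-forms) yields
   finitely supported approximations: delta (chi_n psi) only involves d chi_n,
   and Cauchy-Schwarz together with (iii) bounds its norm by the norm of psi over
   the edges where chi_n is not constant, a tail of a convergent sum.  Hence psi
   is in the kernel of the closure.  Orthogonality is Green's formula for finite
   sums, followed by a limit. *)

Require Import Defs.
From mathcomp Require Import all_boot all_order all_algebra finmap.
From mathcomp Require Import all_classical all_reals all_analysis.
From mathcomp Require Import ring lra.
Set Implicit Arguments.
Unset Strict Implicit.
Unset Printing Implicit Defensive.
Import Order.TTheory GRing.Theory Num.Theory.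
Import numFieldNormedType.Exports.
Local Open Scope classical_set_scope.
Local Open Scope ring_scope.

(** The argument is phrased with real-valued squared norms [q] and the parallelogram law, since the
    norms of the statement take extended real values and its inner products are infinite sums. Inner
    products enter only through finite sums: a minimizer of [q] is tested against finitely supported
    elements, and the final orthogonality is reduced to approximants for which the finite sum is
    exactly 0.

    Two facts link closures to pointwise formulas. Evaluation at a vertex or an edge is bounded, so
    [d_bar] and [delta_bar] act by the formulas of [dK] and [deltaK]. The converse is the real
    obstacle: [delta_bar] is defined as a closure and not as the adjoint of [d_bar], so a
    square-summable solution of [deltaK psi = 0] is not at once in its domain. This is where
    chi-completeness enters.

    Positivity at infinity speaks of pairs under [D_bar]; applied to pairs [(f, 0)] and [(0, phi)]
    it yields the separate lower bounds for [d_bar] and [delta_bar]. *)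

Section ComplexNormSq.
Variable R : realType.
Implicit Types (z w : R[i]).

(** Squared modulus as a real polynomial in the two parts: identities are settled by [ring] after
    destructing, and no square root appears. *)
Definition normsq z : R := complex.Re z ^+ 2 + complex.Im z ^+ 2.

Lemma normsq_ge0 z : 0 <= normsq z.
Proof. by rewrite addr_ge0 ?sqr_ge0. Qed.

Lemma normc_sqr z : Normc.normc z ^+ 2 = normsq z.
Proof. by case: z => a b /=; rewrite sqr_sqrtr ?normsq_ge0// addr_ge0 ?sqr_ge0. Qed.

Lemma normsqM z w : normsq (z * w) = normsq z * normsq w.
Proof. by case: z w => [a b] [c d]; rewrite /normsq /=; ring. Qed.

Lemma normsqN z : normsq (- z) = normsq z.
Proof. by case: z => [a b]; rewrite /normsq /=; ring. Qed.

Lemma normsq0 : normsq 0 = 0.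
Proof. by rewrite /normsq /=; ring. Qed.

Lemma normsqC z w : normsq (z - w) = normsq (w - z).
Proof. by rewrite -opprB normsqN. Qed.

Lemma normsq_par z w :
  normsq (z + w) + normsq (z - w) = 2 * normsq z + 2 * normsq w.
Proof. by case: z w => [a b] [c d]; rewrite /normsq /=; ring. Qed.

Lemma normsqD_le z w : normsq (z + w) <= 2 * normsq z + 2 * normsq w.
Proof. by rewrite -normsq_par lerDl normsq_ge0. Qed.

Lemma normsq_eq0 z : normsq z = 0 -> z = 0.
Proof.
by case: z => [a b] /= /eqP; rewrite paddr_eq0 ?sqr_ge0// !sqrf_eq0 /=;
  case/andP => /eqP -> /eqP ->.
Qed.

Lemma real_complete (u : nat -> R) :
  (forall eps, 0 < eps -> exists N, forall m n, (N <= m)%N -> (N <= n)%N ->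
       (u m - u n) ^+ 2 <= eps) ->
  exists x, forall eps, 0 < eps -> exists N, forall n, (N <= n)%N ->
       (u n - x) ^+ 2 <= eps.
Proof.
move=> uC.
have : cvg (u @ \oo).
  apply: cauchy_cvg; apply: cauchy_exP => e e0.
  (* Half of [e] turns the large inequality of the hypothesis into the strict one of [ball]. *)
  have e20 : 0 < (e / 2) ^+ 2 by rewrite exprn_gt0// divr_gt0.
  have [N HN] := uC _ e20.
  exists (u N); exists N => // n /= Nn; rewrite /ball /=.
  have := HN _ _ (leqnn N) Nn; rewrite -[in leLHS]real_normK ?num_real//.
  have ge20 : 0 <= e / 2 by rewrite divr_ge0 ?(ltW e0).
  rewrite ler_sqr ?nnegrE//.
  by move=> /le_lt_trans; apply; rewrite ltr_pdivrMr// ltr_pMr// ltr1n.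
move=> /cvgrPdist_le cu; exists (lim (u @ \oo)) => eps e0.
have /cu[N _ HN] : 0 < Num.sqrt eps by rewrite sqrtr_gt0.
exists N => n /HN; rewrite distrC => h.
rewrite -[leLHS]real_normK ?num_real// -[leRHS]sqr_sqrtr; last exact: ltW.
by rewrite ler_sqr ?nnegrE ?sqrtr_ge0.
Qed.

Lemma complex_complete (u : nat -> R[i]) :
  (forall eps, 0 < eps -> exists N, forall m n, (N <= m)%N -> (N <= n)%N ->
       normsq (u m - u n) <= eps) ->
  exists x, forall eps, 0 < eps -> exists N, forall n, (N <= n)%N ->
       normsq (u n - x) <= eps.
Proof.
move=> uC.
have [|x xP] := @real_complete (fun n => complex.Re (u n)).
  move=> e /uC[N HN]; exists N => m n Nm Nn; apply: le_trans (HN m n Nm Nn).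
  by rewrite /normsq raddfB/= lerDl sqr_ge0.
have [|y yP] := @real_complete (fun n => complex.Im (u n)).
  move=> e /uC[N HN]; exists N => m n Nm Nn; apply: le_trans (HN m n Nm Nn).
  by rewrite /normsq (raddfB (@complex.Im R))/= lerDr sqr_ge0.
exists (x +i* y)%C => eps e0.
have e20 : 0 < eps / 2 by rewrite divr_gt0.
have [[N HN] [M HM]] := (xP _ e20, yP _ e20).
exists (maxn N M) => n; rewrite geq_max => /andP[/HN hx /HM hy].
move: hx hy; rewrite /normsq /=; case: (u n) => a b /= hx hy; lra.
Qed.

End ComplexNormSq.

(** * Squared norms, projection and closed subspaces *)

Section Quad.
Variable R : realType.

Definition linset (X : lmodType R[i]) (A : set X) :=
  A 0 /\ forall (a : R[i]) x y, A x -> A y -> A (a *: x + y).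

(** Closure in squared distance, with no membership in the ambient space. As [q] is meaningful only
    on [L], closedness of a set is always expressed after intersecting with [L]. *)
Definition adherent (X : zmodType) (q : X -> R) (A : set X) : set X :=
  [set x | forall eps, 0 < eps -> exists2 a, A a & q (a - x) <= eps].

(** A Hilbert space given by its squared norm alone: the parallelogram law stands for the inner
    product and, through [hilbert_leD], for the triangle inequality. Positivity is the only law
    imposed outside [L], where [q] may take default values. *)
Record is_hilbert (X : lmodType R[i]) (L : set X) (q : X -> R) : Prop := {
  hilbert_linset : linset L;
  hilbert_ge0 : forall x, 0 <= q x;
  hilbertZ : forall a x, L x -> q (a *: x) = normsq a * q x;
  hilbert_par : forall x y, L x -> L y ->
    q (x + y) + q (x - y) = 2 * q x + 2 * q y;
  hilbert_complete : forall u : nat -> X, (forall n, L (u n)) ->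
    (forall eps, 0 < eps -> exists N, forall m n, (N <= m)%N -> (N <= n)%N ->
       q (u m - u n) <= eps) ->
    exists2 x, L x & forall eps, 0 < eps -> exists N, forall n, (N <= n)%N ->
       q (u n - x) <= eps }.

Section Subspace.
Variables (X : lmodType R[i]) (A : set X).
Hypothesis sA : linset A.

Lemma linset0 : A 0. Proof. by case: sA. Qed.

Lemma linsetD x y : A x -> A y -> A (x + y).
Proof. by move=> Ax Ay; rewrite -[x]scale1r; apply sA. Qed.

Lemma linsetZ a x : A x -> A (a *: x).
Proof. by move=> Ax; rewrite -[_ *: _]addr0; apply sA => //; apply: linset0. Qed.

Lemma linsetN x : A x -> A (- x).
Proof. by rewrite -scaleN1r; apply: linsetZ. Qed.

Lemma linsetB x y : A x -> A y -> A (x - y).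
Proof. by move=> Ax /linsetN; apply: linsetD. Qed.

End Subspace.

Lemma exists_inv_le (eps : R) : 0 < eps ->
  exists N, forall n, (N <= n)%N -> n.+1%:R^-1 <= eps.
Proof.
move=> e0; exists (Num.truncn eps^-1) => n Nn.
rewrite -[eps]invrK lef_pV2 ?posrE ?invr_gt0//.
by rewrite ltW// (lt_le_trans (truncnS_gt _))// ler_nat ltnS.
Qed.

Section Hilbert.
Variables (X : lmodType R[i]) (L : set X) (q : X -> R).
Hypothesis hL : is_hilbert L q.
Let sL := hilbert_linset hL.

Lemma hilbert0 : q 0 = 0.
Proof.
by have := hilbertZ hL 0 (linset0 sL); rewrite scale0r normsq0 mul0r.
Qed.

Lemma hilbertN x : L x -> q (- x) = q x.
Proof.
move=> Lx; rewrite -scaleN1r (hilbertZ hL)//.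
by rewrite normsqN /normsq /= expr1n expr0n addr0 mul1r.
Qed.

Lemma hilbert_subC x y : L x -> L y -> q (x - y) = q (y - x).
Proof. by move=> Lx Ly; rewrite -opprB hilbertN//; exact: linsetB. Qed.

Lemma hilbert_leD x y : L x -> L y -> q (x + y) <= 2 * q x + 2 * q y.
Proof.
by move=> Lx Ly; rewrite -(hilbert_par hL)// lerDl (hilbert_ge0 hL).
Qed.

Lemma hilbert_leB z x y : L x -> L y -> L z ->
  q (x - y) <= 2 * q (x - z) + 2 * q (y - z).
Proof.
move=> Lx Ly Lz; rewrite -(subrKA z) [in leRHS](hilbert_subC Ly Lz).
by apply: hilbert_leD; exact: linsetB.
Qed.

Lemma rate_Cauchy (f : nat -> nat -> R) (K : R) :
  (forall m n, f m n <= K * (m.+1%:R^-1 + n.+1%:R^-1)) ->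
  forall eps, 0 < eps -> exists N, forall m n, (N <= m)%N -> (N <= n)%N ->
  f m n <= eps.
Proof.
(* [K] has no prescribed sign; [|K| + 1] is a positive bound for it. *)
move=> Ku eps e0; have K10 : 0 < 2 * (`|K| + 1) by rewrite mulr_gt0// ltr_wpDl.
have [N HN] := exists_inv_le (divr_gt0 e0 K10).
exists N => m n /HN hm /HN hn; apply: le_trans (Ku m n) _.
apply: (@le_trans _ _ ((`|K| + 1) * (m.+1%:R^-1 + n.+1%:R^-1))).
  by rewrite ler_wpM2r ?addr_ge0// (le_trans (ler_norm K))// lerDl.
rewrite [leRHS](_ : eps =
    (`|K| + 1) * (eps / (2 * (`|K| + 1)) + eps / (2 * (`|K| + 1)))).
  by rewrite ler_wpM2l ?addr_ge0// lerD.
by have := normr_ge0 K => K0; field; lra.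
Qed.

Lemma hilbert_cvg (K : R) (u : nat -> X) : (forall n, L (u n)) ->
  (forall m n, q (u m - u n) <= K * (m.+1%:R^-1 + n.+1%:R^-1)) ->
  exists2 x, L x & forall eps, 0 < eps -> exists N, forall n, (N <= n)%N ->
       q (u n - x) <= eps.
Proof. by move=> Lu /rate_Cauchy; exact: hilbert_complete. Qed.

Lemma adherent_seq (A : set X) x : adherent q A x ->
  exists u : nat -> X, forall n, A (u n) /\ q (u n - x) <= n.+1%:R^-1.
Proof.
move=> Ax; suff /choice[u uP] : forall n : nat, exists a,
    A a /\ q (a - x) <= n.+1%:R^-1 by exists u.
by move=> n; have [|a Aa qa] := Ax n.+1%:R^-1; [rewrite invr_gt0|exists a].
Qed.

Lemma adherent_seq_rate (u : nat -> X) x : L x -> (forall n, L (u n)) ->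
  (forall n, q (u n - x) <= n.+1%:R^-1) ->
  forall m n, q (u m - u n) <= 2 * (m.+1%:R^-1 + n.+1%:R^-1).
Proof.
move=> Lx Lu qu m n; apply: le_trans (hilbert_leB (Lu m) (Lu n) Lx) _.
by rewrite -mulrDr ler_wpM2l// lerD.
Qed.

(* If m_n is a minimizing sequence with limit m then 2 m_n - m lies in M, and
   the parallelogram law bounds q (x - m) through q (x - (2 m_n - m)) without
   using the continuity of q. *)
Lemma hilbert_projection (M : set X) x : linset M -> M `<=` L ->
  L `&` adherent q M `<=` M -> L x ->
  exists2 m, M m & forall m', M m' -> q (x - m) <= q (x - m - m').
Proof.
move=> sM ML clM Lx.
pose I := [set q (x - m) | m in M].
have I_inf : has_inf I.
  split; first by exists (q (x - 0)); exists 0 => //; exact: linset0.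
  by exists 0 => _ [m _ <-]; exact: hilbert_ge0 hL _.
have infI m : M m -> inf I <= q (x - m).
  by move=> Mm; apply: ge_inf; [case: I_inf|exists m].
have /choice[u uP] : forall n : nat, exists m,
    M m /\ q (x - m) <= inf I + n.+1%:R^-1.
  move=> n; have n0 : 0 < n.+1%:R^-1 :> R by rewrite invr_gt0.
  by have [_ [m Mm <-] /ltW] := inf_adherent n0 I_inf; exists m.
have Lu n : L (u n) by apply: ML; case: (uP n).
have [m n|m Lm um] := @hilbert_cvg 2 u Lu.
  have [[Mm qm] [Mn qn]] := (uP m, uP n).
  have := hilbert_par hL (linsetB sL Lx (Lu m)) (linsetB sL Lx (Lu n)).
  have -> : x - u m + (x - u n) = 2%:R *: (x - 2^-1 *: (u m + u n)).
    rewrite scalerBr scalerA divff ?pnatr_eq0// scale1r scaler_nat mulr2n.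
    by rewrite addrACA opprD.
  have Mmn : M (2^-1 *: (u m + u n)) by apply: linsetZ => //; exact: linsetD.
  rewrite (hilbertZ hL); last by apply: (linsetB sL) => //; exact: ML.
  have -> : x - u m - (x - u n) = u n - u m.
    by rewrite opprB addrC addrA subrK.
  have -> : normsq (2%:R : R[i]) = 4 by rewrite /normsq /=; ring.
  rewrite (hilbert_subC (Lu n) (Lu m)).
  have := infI _ Mmn; move: (m.+1%:R^-1) (n.+1%:R^-1) qm qn => a b *; lra.
have Mm : M m.
  apply: clM; split=> // eps /um[N HN].
  by exists (u N); [case: (uP N)|exact: HN].
exists m => // m' Mm'; apply: le_trans (_ : inf I <= _); last first.
  by rewrite -addrA -opprD; apply: infI; exact: linsetD.
apply/ler_addgt0Pr => e e0.
have e40 : 0 < e / 4 by rewrite divr_gt0.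
have [N HN] := um _ e40; have [N' HN'] := exists_inv_le e40.
pose n := maxn N N'; have := HN n (leq_maxl _ _); have := HN' n (leq_maxr _ _).
have [Mn] := uP n.
have := hilbert_par hL (linsetB sL Lx (Lu n)) (linsetB sL (Lu n) Lm).
rewrite addrA subrK.
have -> : x - u n - (u n - m) = x - (2%:R *: u n - m).
  by rewrite scaler_nat mulr2n -!addrA -!opprD addrA.
have M2 : M (2%:R *: u n - m) by apply: linsetB => //; exact: linsetZ.
have := infI _ M2; move: (n.+1%:R^-1) => a *; lra.
Qed.

End Hilbert.
End Quad.

(** * Closed ranges: operators bounded below, and adding one line *)

Section Range.
Variable R : realType.

Lemma linset_adherent (X : lmodType R[i]) (L : set X) (q : X -> R)
    (A : set X) : is_hilbert L q -> A `<=` L -> linset A ->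
  linset (L `&` adherent q A).
Proof.
move=> hL AL sA; have sL := hilbert_linset hL; split.
  split; first exact: linset0.
  move=> e e0; exists 0; first exact: linset0.
  by rewrite subr0 (hilbert0 hL) ltW.
move=> a x y [Lx Ax] [Ly Ay]; split; first exact: (proj2 sL).
move=> e e0.
have a0 : 0 < 4 * (normsq a + 1) by rewrite mulr_gt0// ltr_wpDl// normsq_ge0.
have [x' Ax' qx] := Ax _ (divr_gt0 e0 a0).
have [|y' Ay' qy] := Ay (e / 4); first by rewrite divr_gt0.
exists (a *: x' + y'); first exact: (proj2 sA).
have -> : a *: x' + y' - (a *: x + y) = a *: (x' - x) + (y' - y).
  by rewrite scalerBr opprD addrACA.
have Lx' : L (x' - x) by apply: (linsetB sL) => //; exact: AL.
apply: le_trans (hilbert_leD hL (linsetZ sL a Lx') _) _.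
  by apply: (linsetB sL) => //; exact: AL.
rewrite (hilbertZ hL)//.
have : normsq a * q (x' - x) <= e / 4.
  apply: le_trans (_ : (normsq a + 1) * (e / (4 * (normsq a + 1))) <= _).
    by rewrite ler_pM ?normsq_ge0 ?(hilbert_ge0 hL)// lerDl.
  by rewrite le_eqVlt; apply/orP; left; apply/eqP; field; lra.
lra.
Qed.

(** A vector [v] outside the closed subspace [M] has positive distance to it, so the coefficient of
    [v] is controlled by the norm of [m + a *: v]. Along a convergent sequence of such sums the
    coefficients are therefore Cauchy, and the components in [M] converge too. *)
Lemma closed_add_line (X : lmodType R[i]) (L : set X) (q : X -> R)
    (M : set X) v : is_hilbert L q ->
    linset M -> M `<=` L -> L v -> L `&` adherent q M `<=` M ->
  L `&` adherent q [set m + a *: v | m in M & a in [set: R[i]]] `<=`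
    [set m + a *: v | m in M & a in [set: R[i]]].
Proof.
move=> hL sM ML Lv clM x [Lx Nx]; have sL := hilbert_linset hL.
have [Mv|nMv] := pselect (M v).
  exists x; last by exists 0 => //; rewrite scale0r addr0.
  apply: clM; split => // e /Nx[_ [m Mm [a _ <-]] qe].
  by exists (m + a *: v) => //; apply: (linsetD sM) => //; exact: linsetZ.
(* At distance 0 the vector [v] would be adherent to [M], hence in [M]. *)
have [e e0 vM] : exists2 e, 0 < e & forall m, M m -> e <= q (v - m).
  apply: contrapT => nvM; apply/nMv/clM; split=> // e e0.
  apply: contrapT => ne; apply: nvM; exists e => // m Mm.
  rewrite (hilbert_subC hL)//; last exact: ML.
  by rewrite leNgt; apply/negP => /ltW qe; apply: ne; exists m.
have [y yP] := adherent_seq Nx.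
have {yP}/choice[m] : forall n, exists m : X, M m /\ exists a,
    q (m + a *: v - x) <= n.+1%:R^-1.
  by move=> n; have [[m Mm [a _ <-]] qn] := yP n; exists m; split=> //; exists a.
move=> /all_and2[Mm /choice[a qa]].
have Lm n : L (m n) by apply: ML.
have Ly n : L (m n + a n *: v).
  by apply: linsetD => //; exact: linsetZ.
have ya := adherent_seq_rate hL Lx Ly qa.
have [|b ab] := @complex_complete _ a.
  apply: (rate_Cauchy (f := fun i j => normsq (a i - a j)) (K := 2 / e)) => i j.
  rewrite mulrAC ler_pdivlMr//.
  apply: le_trans (ya i j).
  have [->|aij] := eqVneq (a i) (a j).
    by rewrite subrr normsq0 mul0r (hilbert_ge0 hL).
  have bij : a i - a j != 0 by rewrite subr_eq0.
  (* Pulling out [a i - a j] leaves [v] minus an element of [M], to which the lower bound [e]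
     applies. *)
  have -> : m i + a i *: v - (m j + a j *: v) =
      (a i - a j) *: (v - (a i - a j)^-1 *: (m j - m i)).
    rewrite scalerBr scalerA divff// scale1r scalerBl opprB opprD.
    by rewrite addrACA addrC.
  have Mij : M ((a i - a j)^-1 *: (m j - m i)).
    by apply: linsetZ => //; exact: linsetB.
  rewrite (hilbertZ hL); last by apply: (linsetB sL) => //; exact: ML.
  by rewrite ler_wpM2l ?normsq_ge0// vM.
exists (x - b *: v); last by exists b => //; rewrite subrK.
have Lxb : L (x - b *: v) by apply: (linsetB sL) => //; exact: linsetZ.
apply: clM; split=> // eps eps0.
have qv := hilbert_ge0 hL v.
have v0 : 0 < 4 * (q v + 1) by lra.
have [N HN] := ab _ (divr_gt0 eps0 v0).
have [|N' HN'] := @exists_inv_le _ (eps / 4); first by rewrite divr_gt0.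
pose n := maxn N N'; have := HN n (leq_maxl _ _); have := HN' n (leq_maxr _ _).
move=> /(le_trans (qa n)) qan qb; exists (m n) => //.
have -> : m n - (x - b *: v) = (m n + a n *: v - x) - (a n - b) *: v.
  by rewrite scalerBl !opprB addrA [m n + _]addrC addrAC [RHS]addrC addrA
     [_ + (_ + m n)]addrA subrK addrC [m n - x]addrC addrAC addrA.
apply: le_trans (hilbert_leD hL _ _) _.
- exact: linsetB.
- by apply: (linsetN sL); exact: linsetZ.
rewrite (hilbertN hL) ?(hilbertZ hL)//; last exact: linsetZ.
have : normsq (a n - b) * q v <= eps / 4.
  apply: le_trans (_ : (eps / (4 * (q v + 1))) * (q v + 1) <= _).
    by rewrite ler_pM ?normsq_ge0// lerDl.
  by rewrite le_eqVlt; apply/orP; left; apply/eqP; field; lra.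
lra.
Qed.

Variables (X Y : lmodType R[i]) (L : set X) (q : X -> R).
Variables (M : set Y) (p : Y -> R).
Hypotheses (hL : is_hilbert L q) (hM : is_hilbert M p).

Definition sum_sq (z : X * Y) := q z.1 + p z.2.

(** The lower bound makes preimages of a convergent sequence of images Cauchy; their limit and the
    limit of the images form a pair adherent to the closed graph [A]. *)
Lemma closed_range (A : set (X * Y)) (C : R) : linset A ->
    A `<=` L `*` M -> (L `*` M) `&` adherent sum_sq A `<=` A ->
    (forall z, A z -> q z.1 <= C * p z.2) ->
  M `&` adherent p (A.`2) `<=` A.`2.
Proof.
move=> sA ALM clA AC y [My] /adherent_seq[v vP].
have /all_and2[/choice[u Auv] qv] := vP.
have Lu n : L (u n) by case: (ALM _ (Auv n)).
have Mv n : M (v n) by case: (ALM _ (Auv n)).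
have [|x Lx ux] := @hilbert_cvg _ _ _ _ hL (`|C| * 2) u Lu.
  move=> m n; apply: le_trans (AC _ (linsetB sA (Auv m) (Auv n))) _.
  apply: le_trans (_ : `|C| * p (v m - v n) <= _).
    by rewrite ler_wpM2r ?(hilbert_ge0 hM)// ler_norm.
  by rewrite -mulrA ler_wpM2l// (adherent_seq_rate hM My Mv qv).
exists x; apply: clA; split=> // e e0.
have e20 : 0 < e / 2 by rewrite divr_gt0.
have [[N HN] [N' HN']] := (ux _ e20, exists_inv_le e20).
pose n := maxn N N'; exists (u n, v n) => //.
have := HN n (leq_maxl _ _); have := HN' n (leq_maxr _ _).
by move=> /(le_trans (qv n)) ? ?; rewrite /sum_sq /=; lra.
Qed.

(** The hypothesis on [b] says that [A0] has codimension at most one in [A], so the range of [A] is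
    that of [A0] plus the line through [b.2]. *)
Lemma closed_range_extend (A A0 : set (X * Y)) (b : X * Y) :
    linset A -> linset A0 -> A `<=` L `*` M -> A0 `<=` A ->
    A b -> (forall z, A z -> exists a, A0 (z - a *: b)) ->
    M `&` adherent p (A0.`2) `<=` A0.`2 ->
  M `&` adherent p (A.`2) `<=` A.`2.
Proof.
move=> sA sA0 ALM A0A Ab AA0 cl0.
have sI : linset A0.`2.
  split; first by exists 0; exact: (linset0 sA0).
  move=> a y y' [x xy] [x' xy']; exists (a *: x + x').
  exact: (proj2 sA0 a _ _ xy xy').
have -> : A.`2 = [set m + a *: b.2 | m in A0.`2 & a in [set: R[i]]].
  apply/seteqP; split=> [y [x xy]|_ [m [x xm] [a _ <-]]].
    have [a xya] := AA0 _ xy; exists (y - a *: b.2).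
      by exists (x - a *: b.1).
    by exists a => //; rewrite subrK.
  exists (x + a *: b.1); rewrite [(_, _)](_ : _ = (x, m) + a *: b)//.
  by apply: (linsetD sA); [exact: A0A|exact: linsetZ].
apply: (closed_add_line hM) => //; last by case: (ALM _ Ab).
by move=> y [x /A0A/ALM[]].
Qed.

End Range.

(** * Weighted l2 spaces *)

Section Bridge.
Variable R : realType.

(** Bridge from sequential closure in extended real norms to the epsilon form in squared norms. The
    differences [u n - x] stay in [L], so their norms are finite. *)
Lemma norm_closureE (X : lmodType R[i]) (L : set X) (N : X -> \bar R)
    (q : X -> R) (A : set X) : linset L ->
    (forall x, L x -> N x = (Num.sqrt (q x))%:E) -> (forall x, 0 <= q x) ->
    A `<=` L -> norm_closure L N A = L `&` adherent q A.
Proof.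
move=> sL NE q0 AL; apply/seteqP; split=> x [Lx].
  move=> [u [Au]] /fine_cvgP[_ /cvgrPdist_le ux]; split=> // e e0.
  have e0' : 0 < Num.sqrt e by rewrite sqrtr_gt0.
  have [n _ Hn] := ux _ e0'; exists (u n) => //.
  have := Hn n (leqnn n); rewrite sub0r normrN /= NE; last first.
    by apply: linsetB => //; exact: AL.
  by rewrite /= ger0_norm ?sqrtr_ge0// ler_sqrt ?(ltW e0).
move=> /adherent_seq[u uP]; split=> //; exists u; split.
  by move=> n; case: (uP n).
have Lu n : L (u n - x) by apply: (linsetB sL) Lx; apply: AL; case: (uP n).
have NuE n : N (u n - x) = (Num.sqrt (q (u n - x)))%:E by exact: NE.
apply/fine_cvgP; split; first by apply: nearW => n; rewrite NuE.
apply/cvgrPdist_le => e e0.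
have [M HM] := exists_inv_le (exprn_gt0 2 e0).
exists M => // n /= /HM Mn; rewrite sub0r normrN NuE/= ger0_norm ?sqrtr_ge0//.
have [_ /le_trans/(_ Mn)] := uP n.
by move=> /ler_wsqrtr; rewrite sqrtr_sqr ger0_norm// (ltW e0).
Qed.

End Bridge.

Lemma ler_sum_subseq (R : realType) (T : eqType) (s1 s2 : seq T) (F : T -> R) :
  uniq s1 -> uniq s2 -> {subset s1 <= s2} -> (forall t, t \in s2 -> 0 <= F t) ->
  \sum_(t <- s1) F t <= \sum_(t <- s2) F t.
Proof.
move=> us1 us2 s12 F0.
have -> : \sum_(t <- s1) F t = \sum_(t <- s2 | t \in s1) F t.
  rewrite -[RHS]big_filter; apply: perm_big; apply: uniq_perm => [//||t].
    exact: filter_uniq.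
  by rewrite mem_filter; case ts: (t \in s1) => //=; rewrite s12.
rewrite [leRHS](bigID (mem s1))/= lerDl big_seq_cond.
by apply: sumr_ge0 => t /andP[/F0].
Qed.

Section RealEsum.
Variables (R : realType) (T : choiceType) (S : set T).
Implicit Types (f : T -> R) (s : seq T).

(** [esum] is a supremum over finite subsets whatever the sign of [f]. This lemma and the next
    replace finite subsets by duplicate-free sequences. *)
Lemma esum_EFin_ge f s : uniq s -> {subset s <= S} ->
  ((\sum_(t <- s) f t)%:E <= \esum_(t in S) (f t)%:E)%E.
Proof.
move=> us sS; apply: esum_ge; exists [set` s].
  by split=> [|t /= /sS /set_mem//]; exact: finite_seq.
by rewrite -fsbig_seq// sumEFin.
Qed.

Lemma esum_EFin_le f (K : \bar R) :
  (forall s, uniq s -> {subset s <= S} -> (\sum_(t <- s) f t)%:E <= K)%E ->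
  (\esum_(t in S) (f t)%:E <= K)%E.
Proof.
move=> fK; apply: ge_ereal_sup => _ [A [finA AS] <-].
rewrite fsbig_finite//= sumEFin; apply: fK => // t.
by rewrite in_fset_set// !inE => /AS.
Qed.

Lemma esum_EFinZ f (k : R) : 0 <= k -> (forall t, S t -> 0 <= f t) ->
  (\esum_(t in S) (k * f t)%:E = k%:E * \esum_(t in S) (f t)%:E)%E.
Proof.
move=> k0 f0.
have le (g : T -> R) (j : R) : 0 <= j -> (forall t, S t -> 0 <= g t) ->
    (\esum_(t in S) (j * g t)%:E <= j%:E * \esum_(t in S) (g t)%:E)%E.
  move=> j0 g0; apply: (@esum_EFin_le (fun t => j * g t)) => s us sS.
  by rewrite -mulr_sumr EFinM lee_wpmul2l// esum_EFin_ge.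
apply/eqP; rewrite eq_le le//=.
have [->|kn0] := eqVneq k 0.
  by rewrite mul0e esum_ge0// => t _; rewrite mul0r.
have kp : 0 < k by rewrite lt_neqAle eq_sym kn0.
(* The reverse inequality is [le] for the family [k * f] and the factor [k^-1]. *)
rewrite -lee_pdivlMl// -[leLHS]/(\esum_(t in S) (f t)%:E)%E.
apply: le_trans (le (fun t => k * f t) k^-1 _ _); last 2 first.
- by rewrite invr_ge0.
- by move=> t /f0; exact: mulr_ge0.
by apply: le_esum => t _; rewrite mulKf.
Qed.

Lemma esum_EFin_approx f e : (forall t, S t -> 0 <= f t) ->
    (\esum_(t in S) (f t)%:E < +oo)%E -> 0 < e ->
  exists2 s, uniq s /\ {subset s <= S} &
    (\esum_(t in S) (f t)%:E <= (\sum_(t <- s) f t + e)%:E)%E.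
Proof.
move=> f0 foo e0.
have ffin : \esum_(t in S) (f t)%:E \is a fin_num.
  by rewrite ge0_fin_numE// esum_ge0.
have [_ [A [finA AS] <-] Ae] := ub_ereal_sup_adherent e0 ffin.
exists (fset_set A).
  split; first exact: fset_uniq.
  by move=> t; rewrite in_fset_set// !inE => /AS.
by rewrite EFinD -sumEFin -fsbig_finite// -leeBlDr// ltW.
Qed.

(** A finite set disjoint from [s] can be adjoined to [s] without exceeding the full sum, so it
    carries at most [e]. The tail is stated for a dominated family [g] because cut-off errors have
    this shape: 0 on [s], at most [f] elsewhere. *)
Lemma esum_EFin_tail f e : (forall t, S t -> 0 <= f t) ->
    (\esum_(t in S) (f t)%:E < +oo)%E -> 0 < e ->
  exists2 s, uniq s /\ {subset s <= S} & forall g,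
    (forall t, t \in s -> g t <= 0) -> (forall t, S t -> g t <= f t) ->
    (\esum_(t in S) (g t)%:E <= e%:E)%E.
Proof.
move=> f0 foo e0; have [s [us sS] fs] := esum_EFin_approx f0 foo e0.
exists s => // g gs gf; apply: esum_EFin_le => s' us' s'S.
rewrite lee_fin (bigID (mem s))/=.
have h1 : \sum_(t <- s' | t \in s) g t <= 0 by apply: sumr_le0 => t; exact: gs.
have h2 : \sum_(t <- s' | t \notin s) g t <= \sum_(t <- s' | t \notin s) f t.
  rewrite big_seq_cond [leRHS]big_seq_cond; apply: ler_sum => t /andP[ts' _].
  by apply: gf; have := s'S t ts'; rewrite inE.
have h3 : \sum_(t <- s' | t \notin s) f t + \sum_(t <- s) f t <=
          \sum_(t <- s) f t + e.
  rewrite -big_filter -big_cat/= -lee_fin; apply: le_trans fs.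
  apply: esum_EFin_ge => [|t].
    rewrite cat_uniq us filter_uniq// andbT; apply/hasPn => t ts.
    by rewrite mem_filter /= ts.
  by rewrite mem_cat mem_filter => /orP[/andP[_ /s'S]|/sS].
by move: h1 h2 h3; lra.
Qed.

End RealEsum.

Section L2.
Variables (R : realType) (T : choiceType) (S : set T) (w : T -> R).
Hypothesis w0 : forall t, S t -> 0 < w t.
Implicit Types (x y : T -> R[i]) (s : seq T).

Definition l2sum x : \bar R := \esum_(t in S) (w t * normsq (x t))%:E.

(** [fine] sends [+oo] to 0, so a family of infinite norm gets the value 0; hence the finiteness
    hypotheses on [l2sum] below. *)
Definition l2sq x : R := fine (l2sum x).

Lemma wnormsq_ge0 x t : S t -> 0 <= w t * normsq (x t).
Proof. by move=> St; rewrite mulr_ge0 ?normsq_ge0// ltW// w0. Qed.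

Lemma l2sum_ge0 x : (0 <= l2sum x)%E.
Proof. by apply: esum_ge0 => t St; rewrite lee_fin wnormsq_ge0. Qed.

Lemma l2sq_ge0 x : 0 <= l2sq x.
Proof. by rewrite fine_ge0// l2sum_ge0. Qed.

Lemma l2sumE x : (l2sum x < +oo)%E -> l2sum x = (l2sq x)%:E.
Proof. by move=> xoo; rewrite fineK// ge0_fin_numE// l2sum_ge0. Qed.

Lemma l2sq_le x (e : R) : (l2sum x <= e%:E)%E -> l2sq x <= e.
Proof.
move=> xe; rewrite -lee_fin -l2sumE//.
by apply: le_lt_trans xe _; rewrite ltry.
Qed.

Lemma l2sum_le x (e : R) : (l2sum x < +oo)%E -> l2sq x <= e ->
  (l2sum x <= e%:E)%E.
Proof. by move=> xoo; rewrite l2sumE. Qed.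

Lemma l2sum_leoo x (e : R) : (l2sum x <= e%:E)%E -> (l2sum x < +oo)%E.
Proof. by move=> /le_lt_trans; apply; rewrite ltry. Qed.

Lemma l2sq_sum x s : (l2sum x < +oo)%E -> uniq s -> {subset s <= S} ->
  \sum_(t <- s) w t * normsq (x t) <= l2sq x.
Proof.
move=> xoo us sS; rewrite -lee_fin -l2sumE//.
exact: (esum_EFin_ge (fun t => w t * normsq (x t))).
Qed.

Lemma l2sq_eval x t : (l2sum x < +oo)%E -> S t -> w t * normsq (x t) <= l2sq x.
Proof.
move=> xoo St; have := @l2sq_sum x [:: t] xoo isT.
by rewrite big_seq1; apply => u; rewrite !inE => /eqP ->.
Qed.

Lemma l2sum_par x y :
  (l2sum (x + y)%R + l2sum (x - y)%R = 2%:E * l2sum x + 2%:E * l2sum y)%E.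
Proof.
rewrite /l2sum -!esum_EFinZ//; try by move=> t; exact: wnormsq_ge0.
rewrite -!esumD; try by move=> t St; rewrite lee_fin ?wnormsq_ge0// mulr_ge0 ?wnormsq_ge0.
apply: eq_esum => t _; rewrite -!EFinD -!mulrDr !fctE normsq_par.
by congr (_%:E); ring.
Qed.

Lemma l2sumZ a x : (l2sum (a *: x)%R = (normsq a)%:E * l2sum x)%E.
Proof.
rewrite /l2sum -esum_EFinZ ?normsq_ge0//; last by move=> t; exact: wnormsq_ge0.
by apply: eq_esum => t _; rewrite normsqM mulrCA.
Qed.

Lemma l2sumD_lt x y : (l2sum x < +oo)%E -> (l2sum y < +oo)%E ->
  (l2sum (x + y)%R < +oo)%E.
Proof.
move=> /l2sumE xE /l2sumE yE.
apply: le_lt_trans (leeDl _ (l2sum_ge0 (x - y))) _.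
by rewrite l2sum_par xE yE -!EFinM -EFinD ltry.
Qed.

Lemma l2sumZ_lt a x : (l2sum x < +oo)%E -> (l2sum (a *: x)%R < +oo)%E.
Proof. by rewrite l2sumZ => /l2sumE ->; rewrite -EFinM ltry. Qed.

Lemma l2sum0 : l2sum 0 = 0%E.
Proof. by rewrite /l2sum esum1// => t _; rewrite normsq0 mulr0. Qed.

Lemma l2sum_finsupp x s : (forall t, x t != 0 -> t \in s) ->
  (l2sum x < +oo)%E.
Proof.
move=> xs.
apply: (@l2sum_leoo _ (\sum_(t <- undup s | t \in S) w t * normsq (x t))).
apply: esum_EFin_le => s' us' s'S; rewrite lee_fin.
rewrite (bigID (mem s))/= [X in _ + X]big1 ?addr0; last first.
  move=> t ts; rewrite (_ : x t = 0) ?normsq0 ?mulr0//.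
  by apply/eqP; apply: contraNT ts; exact: xs.
rewrite -big_filter -[leRHS]big_filter; apply: ler_sum_subseq => [|||t].
- exact: filter_uniq.
- by rewrite filter_uniq// undup_uniq.
- by move=> t; rewrite !mem_filter mem_undup => /andP[-> /s'S ->].
by rewrite mem_filter => /andP[/set_mem St _]; exact: wnormsq_ge0.
Qed.

(** [Z] carries the pointwise linear conditions of a cochain space: support in the graph, and
    oddness for 1-forms. *)
Definition l2 (Z : set (T -> R[i])) := [set x | Z x /\ (l2sum x < +oo)%E].

Definition pointwise_cvg (u : nat -> T -> R[i]) x := forall t eps, 0 < eps ->
  exists N, forall n, (N <= n)%N -> normsq (u n t - x t) <= eps.

Lemma pointwise_cvg_sum (u : nat -> T -> R[i]) x s : pointwise_cvg u x ->
  {subset s <= S} -> forall eps, 0 < eps -> exists N, forall n, (N <= n)%N ->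
  \sum_(t <- s) w t * normsq (u n t - x t) <= eps.
Proof.
move=> ux; elim: s => [|t s IH] sS e e0.
  by exists 0%N => n _; rewrite big_nil ltW.
have wt : 0 < w t by apply: w0; have := sS t; rewrite !inE eqxx; apply.
have sS' : {subset s <= S} by move=> v vs; apply: sS; rewrite inE vs orbT.
have [|N HN] := IH sS' (e / 2); first by rewrite divr_gt0.
have [|N' HN'] := ux t (e / 2 / w t); first by rewrite !divr_gt0.
exists (maxn N N') => n; rewrite geq_max big_cons => /andP[/HN h /HN'].
by rewrite ler_pdivlMr// mulrC => h'; lra.
Qed.

(** Completeness: each coordinate is Cauchy because its weight is positive, which gives a pointwise
    limit [x]. As in Fatou's lemma, the norm of [u n - x] is then bounded on finite sets of indices,
    uniformly in the set. *)
Lemma l2_hilbert (Z : set (T -> R[i])) : linset Z ->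
    (forall x t, Z x -> ~ S t -> x t = 0) ->
    (forall u x, (forall n, Z (u n)) -> pointwise_cvg u x -> Z x) ->
  is_hilbert (l2 Z) l2sq.
Proof.
move=> sZ ZS Zc.
have sL : linset (l2 Z).
  split; first by split; [exact: linset0|rewrite l2sum0 ltry].
  move=> a x y [Zx xoo] [Zy yoo]; split; first exact: (proj2 sZ).
  by apply: l2sumD_lt => //; exact: l2sumZ_lt.
split => //.
- exact: l2sq_ge0.
- by move=> a x [_ /l2sumE xE]; rewrite /l2sq l2sumZ xE -EFinM.
- move=> x y Lx Ly; apply: EFin_inj; rewrite !EFinD !EFinM -!l2sumE.
  + exact: l2sum_par.
  + by case: Ly.
  + by case: Lx.
  + by case: (linsetB sL Lx Ly).
  + by case: (linsetD sL Lx Ly).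
move=> u Lu uC.
have Lmn m n : (l2sum (u m - u n)%R < +oo)%E by case: (linsetB sL (Lu m) (Lu n)).
have /choice[x ux] : forall t, exists z, forall eps, 0 < eps ->
    exists N, forall n, (N <= n)%N -> normsq (u n t - z) <= eps.
  (* Off [S] the norm controls nothing, but there every element of [Z] vanishes. *)
  move=> t; have [St|nSt] := pselect (S t); last first.
    exists 0 => e e0; exists 0%N => n _; rewrite (ZS (u n))//.
      by rewrite subrr normsq0 ltW.
    by case: (Lu n).
  apply: complex_complete => e e0.
  have [|N HN] := uC (w t * e); first by rewrite mulr_gt0// w0.
  exists N => m n Nm Nn; have := le_trans (l2sq_eval (Lmn m n) St) (HN m n Nm Nn).
  by rewrite ler_pM2l// w0.
have cx e : 0 < e -> exists N, forall n, (N <= n)%N -> (l2sum (u n - x)%R <= e%:E)%E.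
  move=> e0; have [|N HN] := uC (e / 4); first by rewrite divr_gt0.
  exists N => n Nn; apply: esum_EFin_le => s us sS; rewrite lee_fin.
  have [|M HM] := @pointwise_cvg_sum _ _ s ux sS (e / 4); first by rewrite divr_gt0.
  (* The index [m] depends on the finite set [s] through [M], whereas [N] does not; [m] disappears
     from the final bound. *)
  pose m := maxn M N; have := HM m (leq_maxl _ _).
  have := le_trans (l2sq_sum (Lmn n m) us sS) (HN n m Nn (leq_maxr _ _)).
  have : \sum_(t <- s) w t * normsq ((u n - x) t) <=
      2 * (\sum_(t <- s) w t * normsq ((u n - u m) t)) +
      2 * (\sum_(t <- s) w t * normsq (u m t - x t)).
    rewrite !mulr_sumr -big_split/= big_seq [leRHS]big_seq.
    apply: ler_sum => t /sS; rewrite inE => /w0 wt.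
    rewrite !fctE -[u n t - x t](subrKA (u m t)).
    have := normsqD_le (u n t - u m t) (u m t - x t).
    by move=> /(ler_wpM2l (ltW wt)); lra.
  lra.
have [N /(_ _ (leqnn N)) HN] := cx 1 ltr01.
have Zx : Z x by apply: Zc ux => n; case: (Lu n).
have xoo : (l2sum x < +oo)%E.
  have -> : x = u N + (-1) *: (u N - x).
    by rewrite scaleN1r opprB addrC subrK.
  apply: l2sumD_lt; first by case: (Lu N).
  by apply: l2sumZ_lt; exact: l2sum_leoo HN.
exists x => // e /cx[M HM]; exists M => n /HM; exact: l2sq_le.
Qed.

Lemma l2_tail x e : (l2sum x < +oo)%E -> 0 < e ->
  exists2 s, uniq s /\ {subset s <= S} & forall y,
    (forall t, t \in s -> y t = 0) -> (forall t, S t -> normsq (y t) <= normsq (x t)) ->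
    (l2sum y <= e%:E)%E.
Proof.
move=> xoo e0.
have [s us sP] := esum_EFin_tail (wnormsq_ge0 x) xoo e0.
exists s => // y ys yx; apply: (sP (fun t => w t * normsq (y t))) => t.
  by move=> /ys ->; rewrite normsq0 mulr0.
by move=> St; rewrite ler_pM2l ?w0 ?yx.
Qed.

End L2.

Section ProductAndVanishing.
Variable R : realType.
Variables (X Y : lmodType R[i]) (L : set X) (q : X -> R).
Variables (M : set Y) (p : Y -> R).
Hypotheses (hL : is_hilbert L q) (hM : is_hilbert M p).

Lemma hilbert_prod : is_hilbert (L `*` M) (sum_sq q p).
Proof.
have [[sL q0 qZ qpar qc] [sM p0 pZ ppar pc]] := (hL, hM).
split.
- split; first by split; exact: linset0.
  by move=> a [x y] [x' y'] [/= ? ?] [/= ? ?]; split; [apply: (proj2 sL)|apply: (proj2 sM)].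
- by move=> z; rewrite addr_ge0.
- by move=> a z [? ?]; rewrite /sum_sq /= qZ// pZ// mulrDr.
- move=> z z' [z1 z2] [z1' z2'].
  have h1 : q (z + z').1 + q (z - z').1 = 2 * q z.1 + 2 * q z'.1 by exact: qpar.
  have h2 : p (z + z').2 + p (z - z').2 = 2 * p z.2 + 2 * p z'.2 by exact: ppar.
  by move: h1 h2; rewrite /sum_sq; lra.
move=> u Lu uC.
have [||x Lx ux] := qc (fun n => (u n).1).
- by move=> n; case: (Lu n).
- move=> e /uC[N HN]; exists N => m n Nm Nn.
  by apply: le_trans (HN m n Nm Nn); rewrite lerDl.
have [||y My uy] := pc (fun n => (u n).2).
- by move=> n; case: (Lu n).
- move=> e /uC[N HN]; exists N => m n Nm Nn.
  by apply: le_trans (HN m n Nm Nn); rewrite lerDr.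
exists (x, y) => // e e0; have e20 : 0 < e / 2 by rewrite divr_gt0.
have [[N HN] [N' HN']] := (ux _ e20, uy _ e20).
exists (maxn N N') => n; rewrite geq_max /sum_sq /= => /andP[/HN ? /HN' ?]; lra.
Qed.

Lemma adherent_idem (A : set X) : A `<=` L ->
  L `&` adherent q (L `&` adherent q A) `<=` L `&` adherent q A.
Proof.
move=> AL x [Lx xA]; split=> // e e0.
have e40 : 0 < e / 4 by rewrite divr_gt0.
have [y [Ly yA] yx] := xA _ e40; have [z Az zy] := yA _ e40.
exists z => //; have := hilbert_leB hL (AL _ Az) Lx Ly.
rewrite (hilbert_subC hL Lx Ly); lra.
Qed.

End ProductAndVanishing.

Section Vanishing.
Variables (R : realType) (T : choiceType).
Variables (Y : lmodType R[i]) (L : set (T -> R[i])) (q : (T -> R[i]) -> R).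
Variables (M : set Y) (p : Y -> R).
Hypotheses (hL : is_hilbert L q) (hM : is_hilbert M p).

Definition vanishing_on (s : seq T) : set (T -> R[i]) :=
  [set x | forall t, t \in s -> x t = 0].

Lemma linset_vanishing (A : set ((T -> R[i]) * Y)) (s : seq T) : linset A ->
  linset (A `&` [set z | vanishing_on s z.1]).
Proof.
move=> sA; split; first by split; [exact: linset0|move=> t].
move=> a x y [Ax x0] [Ay y0]; split; first exact: (proj2 sA).
by move=> t ts; rewrite /= !fctE x0 ?y0// scaler0 addr0.
Qed.

(** Evaluation at the points of [s] is bounded on [L], so the vanishing conditions survive
    limits. *)
Lemma closed_vanishing (A : set ((T -> R[i]) * Y)) (s : seq T) :
    A `<=` L `*` M ->
    (L `*` M) `&` adherent (sum_sq q p) A `<=` A ->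
    (forall t, t \in s -> exists k, forall u, L u -> normsq (u t) <= k * q u) ->
  (L `*` M) `&` adherent (sum_sq q p) (A `&` [set z | vanishing_on s z.1]) `<=`
    A `&` [set z | vanishing_on s z.1].
Proof.
move=> ALM clA ev z [LMz zA]; split.
  by apply: clA; split=> // e /zA[a [Aa _] ae]; exists a.
move=> t /[dup] ts /ev[k kP]; apply/normsq_eq0/eqP.
rewrite eq_le normsq_ge0 andbT; apply/ler_addgt0Pr => e e0; rewrite add0r.
have k0 : 0 < `|k| + 1 by rewrite ltr_wpDl.
have [a [Aa a0] ae] := zA _ (divr_gt0 e0 k0).
have Laz : L (a.1 - z.1).
  apply: (linsetB (hilbert_linset hL)); first by case: (ALM _ Aa).
  by case: LMz.
have -> : normsq (z.1 t) = normsq ((a.1 - z.1) t).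
  by rewrite -[(a.1 - z.1) t]/(a.1 t - z.1 t) (a0 t ts) sub0r normsqN.
apply: le_trans (kP _ Laz) _.
have q0 := hilbert_ge0 hL (a.1 - z.1); have p0 := hilbert_ge0 hM (a.2 - z.2).
have qe : q (a.1 - z.1) <= e / (`|k| + 1).
  by apply: le_trans ae; rewrite /sum_sq lerDl.
apply: le_trans (ler_wpM2r q0 (_ : k <= `|k| + 1)) _.
  by rewrite (le_trans (ler_norm k))// lerDl.
by rewrite mulrC -ler_pdivlMr.
Qed.

(** Closedness of the range, known for elements vanishing on [s], is extended to all of [A] by
    releasing the points of [s] one at a time. The element [b] vanishes on the points still
    prescribed and clears the coordinate [t], so each release adds at most one line to the range. *)
Lemma closed_range_vanish (A : set ((T -> R[i]) * Y)) (s : seq T) :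
    linset A -> A `<=` L `*` M ->
    (forall t s', exists2 b, A b /\ vanishing_on s' b.1 &
       forall z, A z -> vanishing_on s' z.1 ->
       exists a, vanishing_on (t :: s') (z.1 - a *: b.1)) ->
    M `&` adherent p (A `&` [set z | vanishing_on s z.1]).`2 `<=`
      (A `&` [set z | vanishing_on s z.1]).`2 ->
  M `&` adherent p A.`2 `<=` A.`2.
Proof.
move=> sA ALM Ab.
have sAs s' := linset_vanishing s' sA.
elim: s => [|t s IH].
  by rewrite (_ : A `&` _ = A)//; apply/seteqP; split=> z; [case|split].
move=> cl; apply: IH; have [b [Abb b0] bP] := Ab t s.
apply: (closed_range_extend (L := L) hM (sAs s) (sAs (t :: s)) _ _ _ _ cl (b := b)).
- by move=> z [/ALM].
- by move=> z [Az z0]; split=> // u us; apply: z0; rewrite inE us orbT.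
- by split.
move=> z [Az z0]; have [a za] := bP z Az z0; exists a; split=> //.
by apply: (linsetB sA) => //; exact: linsetZ.
Qed.

End Vanishing.

Section CauchySchwarz.
Variable R : realType.
Implicit Types (z w : R[i]).

(** Cauchy-Schwarz for a weighted finite sum, without conjugate, since conjugating [y] leaves
    [normsq] unchanged. The induction needs only a bound on the cross term between the head and the
    sum over the tail. *)
Lemma normsq_CS (T : eqType) (s : seq T) (w : T -> R) (x y : T -> R[i]) :
  (forall t, t \in s -> 0 <= w t) ->
  normsq (\sum_(t <- s) (w t)%:C%C * x t * y t) <=
    (\sum_(t <- s) w t * normsq (x t)) * (\sum_(t <- s) w t * normsq (y t)).
Proof.
have nonneg u (v : T -> R[i]) : (forall t, t \in u -> 0 <= w t) ->
    0 <= \sum_(t <- u) w t * normsq (v t).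
  move=> w0; rewrite big_seq; apply: sumr_ge0 => t /w0 wt.
  by rewrite mulr_ge0 ?normsq_ge0.
elim: s => [|t s IH] w0; first by rewrite !big_nil normsq0 mulr0.
rewrite !big_cons.
have ws u : u \in s -> 0 <= w u by move=> us; apply: w0; rewrite inE us orbT.
have wt : 0 <= w t by apply: w0; rewrite inE eqxx.
move: (IH ws) (nonneg s x ws) (nonneg s y ws).
move: (\sum_(j <- s) w j * normsq (x j)) => P.
move: (\sum_(j <- s) w j * normsq (y j)) => Q.
move: (\sum_(j <- s) _) => [a b].
case: (x t) (y t) (w t) wt => [x1 x2] [y1 y2] k k0; rewrite /normsq /= => abPQ P0 Q0.
have cross : 2 * ((x1 * y1 - x2 * y2) * a + (x1 * y2 + x2 * y1) * b) <=
    (x1 ^+ 2 + x2 ^+ 2) * Q + (y1 ^+ 2 + y2 ^+ 2) * P.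
  have [P00|Pn0] := eqVneq P 0.
    move: abPQ; rewrite P00 mul0r => ab0.
    have /andP[/eqP-> /eqP->] : (a == 0) && (b == 0).
      rewrite -(sqrf_eq0 a) -(sqrf_eq0 b) -paddr_eq0 ?sqr_ge0// eq_le ab0.
      by rewrite addr_ge0 ?sqr_ge0.
    by rewrite !mulr0 !addr0 mulr0 mulr_ge0// addr_ge0 ?sqr_ge0.
  have Pp : 0 < P by rewrite lt_neqAle eq_sym Pn0.
  (* With [S] the tail sum [a + i b], the difference multiplied by [P] is [|x|^2 (P Q - |S|^2)] plus
     the squared modulus of [conj(x) S - y P]. The case [P = 0], where [S = 0], was settled
     before. *)
  rewrite -(ler_pM2l Pp) -subr_ge0.
  have xx : 0 <= (x1 ^+ 2 + x2 ^+ 2) by rewrite addr_ge0 ?sqr_ge0.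
  have := ler_wpM2l xx abPQ.
  have := sqr_ge0 (x1 * a + x2 * b - y1 * P).
  have := sqr_ge0 (x1 * b - x2 * a - y2 * P).
  rewrite !expr2; lra.
have := ler_wpM2l k0 cross.
rewrite !expr2 in abPQ *; lra.
Qed.

End CauchySchwarz.

(** * Vanishing of infinite inner products *)

Section RealSum.
Variables (R : realType) (T : choiceType) (S : set T).

Lemma esum_EFin_near (f : T -> R) e : (forall t, S t -> 0 <= f t) ->
    (\esum_(t in S) (f t)%:E < +oo)%E -> 0 < e ->
  exists2 s0 : seq T, {subset s0 <= S} &
    forall s, uniq s -> {subset s <= S} -> {subset s0 <= s} ->
    `|fine (\esum_(t in S) (f t)%:E) - \sum_(t <- s) f t| <= e.
Proof.
move=> f0 foo e0; have [s0 [us0 s0S] fs0] := esum_EFin_approx f0 foo e0.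
have fE : \esum_(t in S) (f t)%:E = (fine (\esum_(t in S) (f t)%:E))%:E.
  by rewrite fineK// ge0_fin_numE// esum_ge0.
exists s0 => // s us sS s0s.
have := esum_EFin_ge f us sS; move: fs0; rewrite fE !lee_fin => fs0 fs.
rewrite ger0_norm ?subr_ge0// lerBlDl (le_trans fs0)// lerD2r.
by apply: ler_sum_subseq => // t /sS /set_mem/f0.
Qed.

(** [real_sum] is a difference of two unconditional sums, of the positive and of the negative parts.
    Domination by [G] keeps both finite, so [fine] returns no default value; on a finite set large
    enough for both parts and for the hypothesis, their difference is the small finite sum. *)
Lemma real_sum_eq0 (F G : T -> R) :
    (forall t, S t -> `|F t| <= G t) -> (\esum_(t in S) (G t)%:E < +oo)%E ->
    (forall eps, 0 < eps -> exists2 s0 : seq T, {subset s0 <= S} &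
      forall s, uniq s -> {subset s <= S} -> {subset s0 <= s} ->
      `|\sum_(t <- s) F t| <= eps) ->
  real_sum S F = 0.
Proof.
move=> FG Goo Fe.
pose Fp t := Num.max (F t) 0; pose Fm t := Num.max (- F t) 0.
have Fp0 t : S t -> 0 <= Fp t by rewrite le_max lexx orbT.
have Fm0 t : S t -> 0 <= Fm t by rewrite le_max lexx orbT.
have FpG t : S t -> Fp t <= G t.
  move=> St; rewrite ge_max (le_trans (ler_norm _) (FG t St)).
  by rewrite (le_trans (normr_ge0 _) (FG t St)).
have FmG t : S t -> Fm t <= G t.
  move=> St; rewrite ge_max (le_trans (normr_ge0 _) (FG t St)) andbT.
  by rewrite (le_trans _ (FG t St))// -normrN ler_norm.
have oo (H : T -> R) : (forall t, S t -> H t <= G t) ->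
    (\esum_(t in S) (H t)%:E < +oo)%E.
  by move=> HG; apply: le_lt_trans (le_esum _) Goo => t /HG; rewrite lee_fin.
rewrite /real_sum.
have -> : \esum_(t in S) (EFin \o F)^\+%E t = \esum_(t in S) (Fp t)%:E.
  by apply: eq_esum => t _; rewrite funeposE -EFin_max.
have -> : \esum_(t in S) (EFin \o F)^\-%E t = \esum_(t in S) (Fm t)%:E.
  by apply: eq_esum => t _; rewrite funenegE -EFinN -EFin_max.
apply/eqP; rewrite -normr_le0; apply/ler_addgt0Pr => e e0; rewrite add0r.
have e30 : 0 < e / 3 by rewrite divr_gt0.
have [s1 s1S Hs1] := esum_EFin_near Fp0 (oo _ FpG) e30.
have [s2 s2S Hs2] := esum_EFin_near Fm0 (oo _ FmG) e30.
have [s3 s3S Hs3] := Fe _ e30.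
pose s := undup (s1 ++ s2 ++ s3).
have sS : {subset s <= S}.
  by move=> t; rewrite mem_undup !mem_cat => /or3P[/s1S|/s2S|/s3S].
have sub (s' : seq T) : {subset s' <= s1 ++ s2 ++ s3} -> {subset s' <= s}.
  by move=> h t /h; rewrite mem_undup.
have us : uniq s by exact: undup_uniq.
have := Hs1 s us sS; have := Hs2 s us sS; have := Hs3 s us sS.
have -> : \sum_(t <- s) F t = \sum_(t <- s) Fp t - \sum_(t <- s) Fm t.
  rewrite -sumrB; apply: eq_bigr => t _; rewrite /Fp /Fm.
  by case: (lerP 0 (F t)) => Ft; rewrite /Num.max; case: ltP; case: ltP; lra.
have s1s : {subset s1 <= s} by apply: sub => t ts; rewrite mem_cat ts.
have s2s : {subset s2 <= s} by apply: sub => t ts; rewrite !mem_cat ts orbT.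
have s3s : {subset s3 <= s} by apply: sub => t ts; rewrite !mem_cat ts !orbT.
move=> /(_ s3s) h3 /(_ s2s) h2 /(_ s1s) h1; move: h1 h2 h3.
by rewrite !ler_norml => /andP[? ?] /andP[? ?] /andP[? ?]; apply/andP; split; lra.
Qed.

End RealSum.

Section L2Orthogonality.
Variables (R : realType) (T : choiceType) (S : set T) (w : T -> R).
Hypothesis w0 : forall t, S t -> 0 < w t.
Implicit Types (x y z : T -> R[i]) (s : seq T).

(** Changing finitely many coordinates changes the squared norm by the change of a finite sum.
    Minimality needs only this inequality. *)
Lemma l2sq_change x y s : (l2sum S w x < +oo)%E -> uniq s -> {subset s <= S} ->
    (forall t, t \notin s -> y t = x t) ->
  l2sq S w y + \sum_(t <- s) w t * normsq (x t) <=
    l2sq S w x + \sum_(t <- s) w t * normsq (y t).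
Proof.
move=> xoo us sS yx; rewrite -lerBrDr; apply: l2sq_le => //.
apply: esum_EFin_le => s' us' s'S; rewrite lee_fin (bigID (mem s))/=.
have : \sum_(t <- s' | t \in s) w t * normsq (y t) <=
    \sum_(t <- s) w t * normsq (y t).
  rewrite -big_filter; apply: ler_sum_subseq => // [||t /sS /set_mem].
  - exact: filter_uniq.
  - by move=> t; rewrite mem_filter => /andP[].
  exact: (wnormsq_ge0 w0).
have : \sum_(t <- s' | t \notin s) w t * normsq (y t) +
    \sum_(t <- s) w t * normsq (x t) <= l2sq S w x.
  rewrite (eq_bigr (fun t => w t * normsq (x t))); last by move=> t /yx ->.
  rewrite -big_filter -big_cat/=; apply: l2sq_sum => // [|t].
    rewrite cat_uniq us filter_uniq// andbT; apply/hasPn => t ts.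
    by rewrite mem_filter /= ts.
  by rewrite mem_cat mem_filter => /orP[/andP[_ /s'S]|/sS].
lra.
Qed.

(** First variation at a minimizer: comparing [x] with [x - a *: y] gives
    [2 Re(conj(a) I) <= |a|^2 M] for every complex [a], where [I] is the finite inner product and
    [M] the squared norm of [y]. *)
Lemma l2_minimal_orthogonal x y s : (l2sum S w x < +oo)%E ->
    uniq s -> {subset s <= S} -> (forall t, t \notin s -> y t = 0) ->
    (forall a : R[i], l2sq S w x <= l2sq S w (x - a *: y)) ->
  \sum_(t <- s) (w t)%:C%C * x t * (y t)^* = 0.
Proof.
move=> xoo us sS y0 xmin.
set I := \sum_(t <- s) _; pose M := \sum_(t <- s) w t * normsq (y t).
have M0 : 0 <= M.
  rewrite /M big_seq; apply: sumr_ge0 => t /sS; rewrite inE => St.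
  exact: (wnormsq_ge0 w0).
have key a : 2 * complex.Re (a^* * I) <= normsq a * M.
  have E : \sum_(t <- s) w t * normsq ((x - a *: y) t) =
      \sum_(t <- s) w t * normsq (x t) - 2 * complex.Re (a^* * I) + normsq a * M.
    rewrite /I /M !mulr_sumr raddf_sum mulr_sumr -sumrB -big_split/=.
    apply: eq_bigr => t _; rewrite -[(x - a *: y) t]/(x t - a * y t).
    by case: (x t) (y t) a => [x1 x2] [y1 y2] [a1 a2]; rewrite /normsq /=; ring.
  have := @l2sq_change x (x - a *: y) s xoo us sS; rewrite E.
  have xa : forall t, t \notin s -> (x - a *: y) t = x t.
    by move=> t /y0 yt; rewrite -[(x - a *: y) t]/(x t - a * y t) yt mulr0 subr0.
  by move=> /(_ xa); have := xmin a; lra.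
have M1 : 0 < M + 1 by lra.
have M1n : M + 1 != 0 by rewrite gt_eqF.
(* The choice [a = I / (M + 1)] gives [2 (M + 1) |I|^2 <= M |I|^2], hence [I = 0]; [M + 1] is safe
   when [M = 0]. *)
have := key (((M + 1)^-1)%:C%C * I).
have -> : complex.Re ((((M + 1)^-1)%:C%C * I)^* * I) = (M + 1)^-1 * normsq I.
  by case: (I) => [a b]; rewrite /normsq /=; ring.
rewrite normsqM.
have -> : normsq (((M + 1)^-1)%:C%C : R[i]) = (M + 1)^-1 ^+ 2.
  by rewrite /normsq /=; ring.
have I0 := normsq_ge0 I.
move=> /(ler_wpM2l (ltW (exprn_gt0 2 M1))) h.
apply/normsq_eq0/eqP; rewrite eq_le I0 andbT.
have h1 : (M + 1) ^+ 2 * (2 * ((M + 1)^-1 * normsq I)) = 2 * (M + 1) * normsq I.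
  by field.
have h2 : (M + 1) ^+ 2 * ((M + 1)^-1 ^+ 2 * normsq I * M) = normsq I * M.
  by field.
move: h; rewrite h1 h2.
have := mulr_ge0 M0 I0; lra.
Qed.

(** A finitely supported [z] close to [y] and orthogonal to [x] can be subtracted from [y] in any
    finite sum over a set containing its support; Cauchy-Schwarz then bounds what remains by the
    distance from [z] to [y]. *)
Lemma l2_inner_eq0 x y : (l2sum S w x < +oo)%E -> (l2sum S w y < +oo)%E ->
    (forall eps, 0 < eps -> exists2 z, (l2sum S w (z - y)%R <= eps%:E)%E &
      exists s, [/\ uniq s, {subset s <= S}, forall t, t \notin s -> z t = 0 &
        \sum_(t <- s) (w t)%:C%C * x t * (z t)^* = 0]) ->
  complex_sum S (fun t => (w t)%:C%C * x t * (y t)^*) = 0.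
Proof.
move=> xoo yoo yz.
have Goo : (\esum_(t in S) (w t * normsq (x t) + w t * normsq (y t))%:E < +oo)%E.
  under eq_esum do rewrite EFinD.
  rewrite esumD; try by move=> t St; rewrite lee_fin (wnormsq_ge0 w0).
  by rewrite -/(l2sum S w x) -/(l2sum S w y) (l2sumE w0 xoo) (l2sumE w0 yoo) ltry.
have xx := l2sq_ge0 w0 x.
have small e : 0 < e -> exists2 s0 : seq T, {subset s0 <= S} &
      forall s, uniq s -> {subset s <= S} -> {subset s0 <= s} ->
      normsq (\sum_(t <- s) (w t)%:C%C * x t * (y t)^*) <= e ^+ 2.
  move=> e0; have [|z zy [s0 [us0 s0S z0 s0z]]] := yz (e ^+ 2 / (l2sq S w x + 1)).
    by rewrite divr_gt0 ?exprn_gt0//; lra.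
  exists s0 => // s us sS s0s.
  have -> : \sum_(t <- s) (w t)%:C%C * x t * (y t)^* =
      \sum_(t <- s) (w t)%:C%C * x t * (y t - z t)^*.
    rewrite -[LHS]subr0 -[X in _ - X = _]s0z.
    have -> : \sum_(t <- s0) (w t)%:C%C * x t * (z t)^* =
        \sum_(t <- s) (w t)%:C%C * x t * (z t)^*.
      rewrite [RHS](bigID (mem s0))/= [X in _ = _ + X]big1 ?addr0; last first.
        by move=> t /z0 ->; rewrite conjC0 mulr0.
      rewrite -[RHS]big_filter; apply: perm_big; apply: uniq_perm => //.
        by rewrite filter_uniq.
      move=> t; rewrite mem_filter; case ts: (t \in s0) => //=.
      by rewrite s0s.
    by rewrite -sumrB; apply: eq_bigr => t _; rewrite rmorphB mulrBr.
  apply: le_trans (normsq_CS _ _ _) _.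
    by move=> t /sS; rewrite inE => /w0/ltW.
  have h1 := l2sq_sum w0 xoo us sS.
  have zyoo := l2sum_leoo zy.
  have h2 : \sum_(t <- s) w t * normsq (y t - z t)^* <= l2sq S w (z - y).
    apply: le_trans (l2sq_sum w0 zyoo us sS).
    rewrite le_eqVlt; apply/orP; left; apply/eqP; apply: eq_bigr => t _.
    rewrite !fctE -(normsqC (y t)); congr (_ * _).
    by case: (y t - z t) => a b; rewrite /normsq /=; ring.
  have h3 := l2sq_le w0 zy.
  have nn (v : T -> R[i]) : 0 <= \sum_(t <- s) w t * normsq (v t).
    by rewrite big_seq; apply: sumr_ge0 => t /sS; rewrite inE => St; exact: (wnormsq_ge0 w0).
  apply: le_trans (ler_pM (nn _) (nn _) h1 (le_trans h2 h3)) _.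
  rewrite mulrCA ler_piMr ?exprn_ge0 ?(ltW e0)//.
  by rewrite ler_pdivrMr ?mul1r; lra.
(* [f] stands for the real part and for the imaginary part. *)
have bound (f : R[i] -> R) : (forall u, `|f u| ^+ 2 <= normsq u) ->
    {morph f : u v / u + v} -> f 0 = 0 ->
    real_sum S (fun t => f ((w t)%:C%C * x t * (y t)^*)) = 0.
  move=> fn fD f0; apply: real_sum_eq0 Goo _ => [t St|e e0].
    have wt := w0 St.
    have := fn ((w t)%:C%C * x t * (y t)^*).
    have -> : normsq ((w t)%:C%C * x t * (y t)^*) =
        w t ^+ 2 * (normsq (x t) * normsq (y t)).
      by case: (x t) (y t) => [a b] [c d]; rewrite /normsq /=; ring.
    have [x0 y0] := (normsq_ge0 (x t), normsq_ge0 (y t)).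
    move=> h; rewrite -ler_sqr ?nnegrE ?addr_ge0 ?mulr_ge0 ?(ltW wt)//.
    apply: le_trans h _; rewrite -mulrDr exprMn ler_wpM2l ?sqr_ge0//.
    by rewrite sqrrD; have := mulr_ge0 x0 y0; have := sqr_ge0 (normsq (x t));
       have := sqr_ge0 (normsq (y t)); lra.
  have [s0 s0S Hs0] := small e e0; exists s0 => // s us sS s0s.
  rewrite -(big_morph f fD f0) -ler_sqr ?nnegrE ?(ltW e0)//.
  exact: le_trans (fn _) (Hs0 s us sS s0s).
rewrite /complex_sum !bound//.
- by move=> u; rewrite real_normK ?num_real// lerDr sqr_ge0.
- by move=> u v; rewrite (raddfD (@complex.Im R)).
- by move=> u; rewrite real_normK ?num_real// lerDl sqr_ge0.
- by move=> u v; rewrite raddfD.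
Qed.

End L2Orthogonality.

(** * The closures of d, delta and D *)

Section GraphL2.
Variables (R : realType) (V : choiceType) (K : graph V).
Variables (c : V -> R) (r : V * V -> R).
Hypotheses (Klocfin : locally_finite K) (Kweights : weights K c r).
Implicit Types (f g : V -> R[i]) (phi psi : V * V -> R[i]).

(** The factor 1/2 of the edge norm, there because each unoriented edge is counted twice, is moved
    into the weight, so that edges and vertices are both instances of [l2sum]. *)
Definition half_r e := r e / 2.

Lemma weightV_gt0 v : vertices K v -> 0 < c v.
Proof. by case: Kweights => + _ _; apply. Qed.

Lemma weightE_gt0 e : edges K e -> 0 < r e.
Proof. by case: Kweights => _ + _; apply. Qed.

Lemma weightE_sym x y : edges K (x, y) -> r (y, x) = r (x, y).
Proof. by case: Kweights => _ _ + /[dup] => /[apply]. Qed.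

Lemma half_r_gt0 e : edges K e -> 0 < half_r e.
Proof. by move=> /weightE_gt0 re; rewrite divr_gt0. Qed.

Local Notation qV := (l2sq (vertices K) c).
Local Notation qE := (l2sq (edges K) half_r).
Local Notation sumV := (l2sum (vertices K) c).
Local Notation sumE := (l2sum (edges K) half_r).
Local Notation LV := (L2V K c).
Local Notation LE := (L2E K r).

Lemma sqrte_lty (x : \bar R) : (sqrte x < +oo)%E = (x < +oo)%E.
Proof. by case: x => [x||] //=; rewrite !ltry. Qed.

Lemma normV_l2sum f : normV K c f = sqrte (sumV f).
Proof. by congr sqrte; apply: eq_esum => v _; rewrite normc_sqr. Qed.

Lemma normE_l2sum phi : normE K r phi = sqrte (sumE phi).
Proof.
rewrite /normE /l2sum -esum_EFinZ ?invr_ge0//; last first.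
  by move=> e Ke; rewrite mulr_ge0 ?sqr_ge0// ltW// weightE_gt0.
by congr sqrte; apply: eq_esum => e _; rewrite normc_sqr mulrA [_^-1 * _]mulrC.
Qed.

Lemma L2VE f : LV f <-> C0 K f /\ (sumV f < +oo)%E.
Proof. by rewrite /L2V /= normV_l2sum sqrte_lty. Qed.

Lemma L2EE phi : LE phi <-> C1 K phi /\ (sumE phi < +oo)%E.
Proof. by rewrite /L2E /= normE_l2sum sqrte_lty. Qed.

Lemma pointwise_cvg_eq (T : choiceType) (u : nat -> T -> R[i]) x t z :
  pointwise_cvg u x -> (forall n, u n t = z) -> x t = z.
Proof.
move=> ux uz; apply/eqP; rewrite eq_sym -subr_eq0; apply/eqP/normsq_eq0/eqP.
rewrite eq_le normsq_ge0 andbT; apply/ler_addgt0Pr => e e0; rewrite add0r.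
by have [N /(_ N (leqnn N))] := ux t e e0; rewrite uz.
Qed.

Lemma linset_C0 : linset (C0 (R := R) K).
Proof.
split=> [v|a x y x0 y0 v nv] //.
by rewrite !fctE x0// y0// scaler0 addr0.
Qed.

Lemma linset_C1 : linset (C1 (R := R) K).
Proof.
split; first by split=> e; rewrite ?oppr0.
move=> a x y [x0 xN] [y0 yN]; split=> e Ke.
  by rewrite !fctE x0// y0// scaler0 addr0.
by rewrite !fctE xN// yN// scalerN opprD.
Qed.

Lemma hilbert_L2V : is_hilbert LV qV.
Proof.
rewrite (_ : LV = l2 (vertices K) c (C0 K)); last first.
  by apply/seteqP; split=> f /L2VE.
apply: (l2_hilbert weightV_gt0 linset_C0) => [f v f0|u f uf uc v nv]; first exact: f0.
by apply: (pointwise_cvg_eq uc) => n; exact: uf.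
Qed.

Lemma hilbert_L2E : is_hilbert LE qE.
Proof.
rewrite (_ : LE = l2 (edges K) half_r (C1 K)); last first.
  by apply/seteqP; split=> f /L2EE.
apply: (l2_hilbert half_r_gt0 linset_C1) => [f e [f0 _]|u f uf uc]; first exact: f0.
split=> e Ke.
  by apply: (pointwise_cvg_eq uc) => n; case: (uf n) => u0 _; exact: u0.
(* Oddness passes to the limit as the vanishing of [u n (-e) + u n e]. *)
have uc' : pointwise_cvg (fun n e => u n (opp_edge e) + u n e)
    (fun e => f (opp_edge e) + f e).
  move=> t eps e0; have e40 : 0 < eps / 4 by rewrite divr_gt0.
  have [[N HN] [M HM]] := (uc (opp_edge t) _ e40, uc t _ e40).
  exists (maxn N M) => n; rewrite geq_max => /andP[/HN ? /HM ?].
  by rewrite opprD addrACA (le_trans (normsqD_le _ _))//; lra.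
apply/eqP; rewrite -addr_eq0; apply/eqP.
apply: (pointwise_cvg_eq uc' (t := e)) => n.
by case: (uf n) => _ uN; rewrite uN// addNr.
Qed.

Lemma normV_sqrt f : LV f -> normV K c f = (Num.sqrt (qV f))%:E.
Proof. by move=> /L2VE[_ /(l2sumE weightV_gt0) fE]; rewrite normV_l2sum fE. Qed.

Lemma normE_sqrt phi : LE phi -> normE K r phi = (Num.sqrt (qE phi))%:E.
Proof. by move=> /L2EE[_ /(l2sumE half_r_gt0) fE]; rewrite normE_l2sum fE. Qed.

Lemma pair_norm_sqrt (X Y : Type) (N : X -> \bar R) (M : Y -> \bar R)
    (q : X -> R) (p : Y -> R) x y : 0 <= q x -> 0 <= p y ->
  N x = (Num.sqrt (q x))%:E -> M y = (Num.sqrt (p y))%:E ->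
  pair_norm N M (x, y) = (Num.sqrt (q x + p y))%:E.
Proof.
move=> q0 p0 NE ME; rewrite /pair_norm NE ME /=.
by rewrite -!expr2 !sqr_sqrtr.
Qed.

Lemma closure_adherent (X Y : lmodType R[i]) (L : set X) (N : X -> \bar R)
    (q : X -> R) (M : set Y) (P : Y -> \bar R) (p : Y -> R) A :
    is_hilbert L q -> is_hilbert M p ->
    (forall x, L x -> N x = (Num.sqrt (q x))%:E) ->
    (forall y, M y -> P y = (Num.sqrt (p y))%:E) ->
    A `<=` L `*` M ->
  op_closure L N M P A = (L `*` M) `&` adherent (sum_sq q p) A.
Proof.
move=> hL hM NE PE ALM; have hLM := hilbert_prod hL hM.
apply: (norm_closureE (hilbert_linset hLM)) => //; last exact: hilbert_ge0 hLM.
move=> [x y] [/= Lx My]; apply: pair_norm_sqrt; first exact: hilbert_ge0 hL _.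
- exact: hilbert_ge0 hM _.
- exact: NE.
- exact: PE.
Qed.

End GraphL2.

Section Operators.
Variables (R : realType) (V : choiceType) (K : graph V).
Variables (c : V -> R) (r : V * V -> R).
Hypotheses (Klocfin : locally_finite K) (Kweights : weights K c r).
Implicit Types (f g : V -> R[i]) (phi psi : V * V -> R[i]).

Local Notation qV := (l2sq (vertices K) c).
Local Notation qE := (l2sq (edges K) (half_r r)).
Local Notation LV := (L2V K c).
Local Notation LE := (L2E K r).
Let c0 := weightV_gt0 Kweights.
Let hr0 := half_r_gt0 Kweights.
Let hV := hilbert_L2V Kweights.
Let hE := hilbert_L2E Kweights.

Definition in_star x := [set e | edges K e /\ e.2 = x].

Lemma edge_vertices e : edges K e -> vertices K e.1 /\ vertices K e.2.
Proof. by move=> /edges_vertices []. Qed.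

Lemma opp_edgeK : involutive (@opp_edge V).
Proof. by case. Qed.

Lemma opp_edge_edges e : edges K e -> edges K (opp_edge e).
Proof. by case: e => x y; exact: edges_sym. Qed.

Lemma finite_in_star x : finite_set (in_star x).
Proof.
have [Kx|nKx] := pselect (vertices K x).
  by apply: sub_finite_set (Klocfin Kx) => e [Ke ex]; split=> //; left.
rewrite (_ : in_star x = set0) ?finite_set0//.
by apply/seteqP; split=> // e [/edge_vertices[_ Ke] ex]; apply: nKx; rewrite -ex.
Qed.

Definition in_star_seq x : seq (V * V) := fset_set (in_star x).

Lemma in_star_seqP x e : reflect (edges K e /\ e.2 = x) (e \in in_star_seq x).
Proof.
rewrite in_fset_set; last exact: finite_in_star.
by apply: (iffP idP) => [/set_mem|/mem_set].
Qed.

Lemma in_star_seq_uniq x : uniq (in_star_seq x).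
Proof. exact: fset_uniq. Qed.

Lemma deltaKE phi x : deltaK K c r phi x =
  ((c x)%:C%C)^-1 * \sum_(e <- in_star_seq x) (r e)%:C%C * phi e.
Proof.
by rewrite /deltaK fsbig_finite//; exact: finite_in_star.
Qed.

Lemma deltaK_nonvertex phi x : ~ vertices K x -> deltaK K c r phi x = 0.
Proof.
move=> nKx; rewrite deltaKE big_seq big1 ?mulr0// => e /in_star_seqP[Ke ex].
by case: nKx; rewrite -ex; case: (edge_vertices Ke).
Qed.

Lemma dKE f e : edges K e -> dK K f e = f e.2 - f e.1.
Proof. by move=> Ke; rewrite /dK mem_set. Qed.

Lemma dK_nonedge f e : ~ edges K e -> dK K f e = 0.
Proof. by move=> nKe; rewrite /dK memNset. Qed.

Lemma dK_linear a f g : dK K (a *: f + g) = a *: dK K f + dK K g.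
Proof.
apply/funext => e; rewrite -[RHS]/(a * dK K f e + dK K g e) /dK.
case: ifP => _; last by rewrite mulr0 addr0.
by rewrite !fctE -![_ *: _]/(_ * _); ring.
Qed.

Lemma deltaK_linear a phi psi :
  deltaK K c r (a *: phi + psi) = a *: deltaK K c r phi + deltaK K c r psi.
Proof.
apply/funext => x; rewrite -[RHS]/(a * deltaK K c r phi x + deltaK K c r psi x).
rewrite !deltaKE mulrCA -mulrDr; congr (_ * _).
rewrite mulr_sumr -big_split/=; apply: eq_bigr => e _.
by rewrite !fctE -![_ *: _]/(_ * _); ring.
Qed.

Lemma dK0 : dK K 0 = 0 :> (V * V -> R[i]).
Proof. by apply/funext => e; rewrite /dK subrr if_same. Qed.

Lemma deltaK0 : deltaK K c r 0 = 0.
Proof.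
by apply/funext => x; rewrite deltaKE big1 ?mulr0// => e _; rewrite mulr0.
Qed.

Lemma dK_C1 f : C1 K (dK K f).
Proof.
split=> e Ke; first exact: dK_nonedge.
by rewrite !dKE ?opprB//; exact: opp_edge_edges.
Qed.

Lemma finite_support_edges f phi : C00 K f ->
    (forall e, phi e != 0 -> edges K e /\ (f e.2 != 0 \/ f e.1 != 0)) ->
  finite_set [set e | phi e != 0].
Proof.
move=> [f0 ff] phif.
apply: (@sub_finite_set _ _ (\bigcup_(v in [set v | f v != 0])
  [set e | edges K e /\ (e.2 = v \/ e.1 = v)])).
  move=> e /= /phif[Ke [fe|fe]]; first by exists e.2 => //; split=> //; left.
  by exists e.1 => //; split=> //; right.
apply: bigcup_finite => // v /= fv; apply: Klocfin.
by apply: contrapT => nv; move: fv; rewrite f0// eqxx.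
Qed.

Lemma dK_C01 f : C00 K f -> C01 K (dK K f).
Proof.
move=> Cf; split; first exact: dK_C1.
apply: (finite_support_edges Cf) => e de.
have Ke : edges K e.
  by apply: contrapT => nKe; move: de; rewrite dK_nonedge// eqxx.
split=> //; have [fe|fe] := eqVneq (f e.2) 0; last by left.
by right; move: de; rewrite dKE// fe sub0r oppr_eq0.
Qed.

Lemma deltaK_C00 phi : C01 K phi -> C00 K (deltaK K c r phi).
Proof.
move=> [phi0 phif]; split; first by move=> v; exact: deltaK_nonvertex.
apply: sub_finite_set (finite_image snd phif) => x /= dx.
apply: contrapT => nx; move: dx; rewrite deltaKE big_seq big1 ?mulr0 ?eqxx//.
move=> e /in_star_seqP[Ke ex]; have [->|pe] := eqVneq (phi e) 0.
  by rewrite mulr0.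
by case: nx; exists e.
Qed.

Lemma C00_L2V : C00 K `<=` LV.
Proof.
move=> f [f0 ff]; apply/L2VE; split=> //.
apply: (l2sum_finsupp c0 (s := fset_set [set v | f v != 0])) => v fv.
by rewrite in_fset_set// mem_set.
Qed.

Lemma C01_L2E : C01 K `<=` LE.
Proof.
move=> f [f0 ff]; apply/(L2EE Kweights); split=> //.
apply: (l2sum_finsupp hr0 (s := fset_set [set v | f v != 0])) => v fv.
by rewrite in_fset_set// mem_set.
Qed.

Lemma finite_support_linear (T : choiceType) (a : R[i]) (x y : T -> R[i]) :
  finite_set [set t | x t != 0] -> finite_set [set t | y t != 0] ->
  finite_set [set t | (a *: x + y) t != 0].
Proof.
move=> fx fy; apply: (@sub_finite_set _ _ ([set t | x t != 0] `|` [set t | y t != 0])).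
  move=> t /=; have [xt|] := eqVneq (x t) 0; last by left.
  have [yt|] := eqVneq (y t) 0; last by right.
  by rewrite !fctE xt yt scaler0 addr0 eqxx.
by rewrite finite_setU.
Qed.

Lemma finite_support0 (T : choiceType) :
  finite_set [set t | (0 : T -> R[i]) t != 0].
Proof.
rewrite (_ : [set _ | _] = set0) ?finite_set0//.
by apply/seteqP; split=> t //=; rewrite eqxx.
Qed.

Lemma linset_C00 : linset (C00 (R := R) K).
Proof.
split; first by split; [exact: linset0 (linset_C0 R K)|exact: finite_support0].
move=> a x y [x0 fx] [y0 fy]; split; first exact: (proj2 (linset_C0 R K)).
exact: finite_support_linear.
Qed.

Lemma linset_C01 : linset (C01 (R := R) K).
Proof.
split; first by split; [exact: linset0 (linset_C1 R K)|exact: finite_support0].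
move=> a x y [x0 fx] [y0 fy]; split; first exact: (proj2 (linset_C1 R K)).
exact: finite_support_linear.
Qed.

Lemma linset_d_op : linset (d_op (R := R) K).
Proof.
split; first by exists 0; [exact: linset0 linset_C00|rewrite dK0].
move=> a _ _ [x Cx <-] [y Cy <-]; exists (a *: x + y).
  exact: (proj2 linset_C00).
by rewrite dK_linear.
Qed.

Lemma linset_delta_op : linset (delta_op K c r).
Proof.
split; first by exists 0; [exact: linset0 linset_C01|rewrite deltaK0].
move=> a _ _ [x Cx <-] [y Cy <-]; exists (a *: x + y).
  exact: (proj2 linset_C01).
by rewrite deltaK_linear.
Qed.

Lemma d_op_L2 : d_op (R := R) K `<=` LV `*` LE.
Proof.
by move=> _ [f Cf <-]; split; [exact: C00_L2V|exact/C01_L2E/dK_C01].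
Qed.

Lemma delta_op_L2 : delta_op K c r `<=` LE `*` LV.
Proof.
by move=> _ [f Cf <-]; split; [exact: C01_L2E|exact/C00_L2V/deltaK_C00].
Qed.

Lemma d_barE : d_bar K c r = (LV `*` LE) `&` adherent (sum_sq qV qE) (d_op K).
Proof.
apply: closure_adherent => //; last exact: d_op_L2.
  by move=> f; exact: (normV_sqrt Kweights).
by move=> f; exact: (normE_sqrt Kweights).
Qed.

Lemma delta_barE :
  delta_bar K c r = (LE `*` LV) `&` adherent (sum_sq qE qV) (delta_op K c r).
Proof.
apply: closure_adherent => //; last exact: delta_op_L2.
  by move=> f; exact: (normE_sqrt Kweights).
by move=> f; exact: (normV_sqrt Kweights).
Qed.

Lemma linset_d_bar : linset (d_bar K c r).
Proof.
rewrite d_barE; apply: linset_adherent; first exact: hilbert_prod.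
  exact: d_op_L2.
exact: linset_d_op.
Qed.

Lemma linset_delta_bar : linset (delta_bar K c r).
Proof.
rewrite delta_barE; apply: linset_adherent; first exact: hilbert_prod.
  exact: delta_op_L2.
exact: linset_delta_op.
Qed.

Lemma d_bar_L2 : d_bar K c r `<=` LV `*` LE.
Proof. by rewrite d_barE => z []. Qed.

Lemma delta_bar_L2 : delta_bar K c r `<=` LE `*` LV.
Proof. by rewrite delta_barE => z []. Qed.

Lemma d_bar_closed : (LV `*` LE) `&` adherent (sum_sq qV qE) (d_bar K c r)
  `<=` d_bar K c r.
Proof.
rewrite d_barE; apply: adherent_idem; first exact: hilbert_prod.
exact: d_op_L2.
Qed.

Lemma delta_bar_closed :
  (LE `*` LV) `&` adherent (sum_sq qE qV) (delta_bar K c r)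
  `<=` delta_bar K c r.
Proof.
rewrite delta_barE; apply: adherent_idem; first exact: hilbert_prod.
exact: delta_op_L2.
Qed.

Lemma d_op_bar f : C00 K f -> d_bar K c r (f, dK K f).
Proof.
move=> Cf; have df : d_op K (f, dK K f) by exists f.
rewrite d_barE; split; first exact: d_op_L2.
by move=> e e0; exists (f, dK K f); rewrite // subrr (hilbert0 (hilbert_prod hV hE)) ltW.
Qed.

Lemma delta_op_bar phi : C01 K phi -> delta_bar K c r (phi, deltaK K c r phi).
Proof.
move=> Cf; have df : delta_op K c r (phi, deltaK K c r phi) by exists phi.
rewrite delta_barE; split; first exact: delta_op_L2.
move=> e e0; exists (phi, deltaK K c r phi); rewrite // subrr.
by rewrite (hilbert0 (hilbert_prod hE hV)) ltW.
Qed.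

End Operators.

Section Evaluation.
Variables (R : realType) (T T' : choiceType).
Variables (L : set (T -> R[i])) (q : (T -> R[i]) -> R).
Variables (M : set (T' -> R[i])) (p : (T' -> R[i]) -> R).
Hypotheses (hL : is_hilbert L q) (hM : is_hilbert M p).

(** If both [op u] and [v] at the point [t] are controlled by the norms, convergence in the graph
    norm forces [y t = op x t]. This shows that the closures of d and delta are given by the
    pointwise formulas. *)
Lemma adherent_graph_eval (op : (T -> R[i]) -> T' -> R[i])
    (D : set (T -> R[i])) x y t k k' :
    (forall a u v, op (a *: u + v) = a *: op u + op v) ->
    D `<=` L -> (forall u, D u -> M (op u)) ->
    (forall u, L u -> normsq (op u t) <= k * q u) ->
    (forall v, M v -> normsq (v t) <= k' * p v) ->
    ((L `*` M) `&` adherent (sum_sq q p) [set (u, op u) | u in D]) (x, y) ->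
  y t = op x t.
Proof.
move=> opL DL DM kL kM [[/= Lx My] xy].
apply/eqP; rewrite -subr_eq0; apply/eqP/normsq_eq0/eqP.
rewrite eq_le normsq_ge0 andbT; apply/ler_addgt0Pr => e e0; rewrite add0r.
pose K := 2 * (`|k| + `|k'| + 1).
have K0 : 0 < K by rewrite mulr_gt0// ltr_wpDl// addr_ge0.
have [_ [u Du <-]] := xy _ (divr_gt0 e0 K0).
rewrite /sum_sq /= => ue.
have Lux : L (u - x) by apply: (linsetB (hilbert_linset hL)) => //; exact: DL.
have Mvy : M (op u - y) by apply: (linsetB (hilbert_linset hM)) => //; exact: DM.
have hu := le_trans (kL _ Lux) (ler_wpM2r (hilbert_ge0 hL _) (ler_norm k)).
have hv := le_trans (kM _ Mvy) (ler_wpM2r (hilbert_ge0 hM _) (ler_norm k')).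
have opB : op (u - x) t = op u t - op x t.
  rewrite -[u - x]addrC -scaleN1r opL -[LHS]/(- 1 * op x t + op u t).
  by rewrite mulN1r addrC.
have -> : y t - op x t = op (u - x) t - (op u - y) t.
  by rewrite opB -[(op u - y) t]/(op u t - y t); ring.
apply: le_trans (normsqD_le _ _) _; rewrite normsqN.
have [qu pv] := (hilbert_ge0 hL (u - x), hilbert_ge0 hM (op u - y)).
have h1 : `|k| * q (u - x) <= `|k| * (e / K) by rewrite ler_wpM2l//; lra.
have h2 : `|k'| * p (op u - y) <= `|k'| * (e / K) by rewrite ler_wpM2l//; lra.
have h3 : e = 2 * (`|k| * (e / K)) + 2 * (`|k'| * (e / K)) + 2 * (e / K).
  by rewrite /K; field; rewrite -/K gt_eqF// -(pmulr_rgt0 _ (ltr0n R 2)).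
have h4 : 0 < e / K by rewrite divr_gt0.
lra.
Qed.

End Evaluation.

Section Cutoff.
Variables (R : realType) (V : choiceType) (K : graph V).
Variables (c : V -> R) (r : V * V -> R).
Hypotheses (Klocfin : locally_finite K) (Kweights : weights K c r).
Implicit Types (f g : V -> R[i]) (phi psi : V * V -> R[i]).

Local Notation qV := (l2sq (vertices K) c).
Local Notation qE := (l2sq (edges K) (half_r r)).
Local Notation LV := (L2V K c).
Local Notation LE := (L2E K r).
Let c0 := weightV_gt0 Kweights.
Let r0 := weightE_gt0 Kweights.
Let hr0 := half_r_gt0 Kweights.
Let hV := hilbert_L2V Kweights.
Let hE := hilbert_L2E Kweights.

Lemma eval_L2V f v : LV f -> vertices K v -> normsq (f v) <= (c v)^-1 * qV f.
Proof.
move=> /L2VE[_ foo] Kv; rewrite mulrC ler_pdivlMr ?c0// mulrC.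
exact: (l2sq_eval c0).
Qed.

Lemma eval_L2E phi e : LE phi -> edges K e ->
  normsq (phi e) <= (half_r r e)^-1 * qE phi.
Proof.
move=> /(L2EE Kweights)[_ foo] Ke; rewrite mulrC ler_pdivlMr ?hr0// mulrC.
exact: (l2sq_eval hr0).
Qed.

Lemma d_bar_dK f phi : d_bar K c r (f, phi) -> phi = dK K f.
Proof.
move=> dfp; have [/= Lf Lphi] := d_bar_L2 Klocfin Kweights dfp.
apply/funext => e; have [Ke|nKe] := pselect (edges K e); last first.
  by rewrite dK_nonedge//; case: Lphi => -[-> //].
move: dfp; rewrite d_barE//.
have [K1 K2] := edge_vertices Ke.
apply: (adherent_graph_eval hV hE (op := dK K) (t := e)
  (k := 2 * (c e.2)^-1 + 2 * (c e.1)^-1) (k' := (half_r r e)^-1)).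
- exact: dK_linear.
- exact: (C00_L2V Kweights).
- by move=> u Cu; apply: (C01_L2E Kweights); exact: (dK_C01 Klocfin).
- move=> u Lu; rewrite dKE//.
  have := eval_L2V Lu K1; have := eval_L2V Lu K2.
  by have := normsqD_le (u e.2) (- u e.1); rewrite normsqN; lra.
- by move=> v Lv; exact: eval_L2E.
Qed.

Lemma delta_bar_deltaK phi f : delta_bar K c r (phi, f) -> f = deltaK K c r phi.
Proof.
move=> dfp; have [/= Lphi Lf] := delta_bar_L2 Klocfin Kweights dfp.
apply/funext => x; have [Kx|nKx] := pselect (vertices K x); last first.
  by rewrite (deltaK_nonvertex _ _ Klocfin)//; case: Lf => ->.
move: dfp; rewrite delta_barE//.
(* The constant [k] comes from Cauchy-Schwarz over the in-star against the constant 1: the total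
   weight of the star, times 2 because [qE] is taken with [half_r], times the square of
   [1 / c x]. *)
apply: (adherent_graph_eval hE hV (op := deltaK K c r) (t := x)
  (k := (c x)^-1 ^+ 2 * ((\sum_(e <- in_star_seq K x) r e) * 2))
  (k' := (c x)^-1)).
- exact: deltaK_linear.
- exact: (C01_L2E Kweights).
- by move=> u Cu; apply: (C00_L2V Kweights); exact: (deltaK_C00 _ _ Klocfin).
- move=> u Lu; rewrite (deltaKE _ _ Klocfin) normsqM -mulrA.
  have -> : normsq ((c x)%:C%C^-1 : R[i]) = (c x)^-1 ^+ 2.
    by rewrite -fmorphV /normsq /=; ring.
  rewrite ler_wpM2l ?sqr_ge0//.
  have rs e : e \in in_star_seq K x -> 0 <= r e.
    by move=> /(in_star_seqP Klocfin)[Ke _]; exact/ltW/r0.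
  have := normsq_CS (fun=> 1) u rs.
  under eq_bigr do rewrite mulr1.
  move=> /le_trans; apply; rewrite -mulrA.
  have -> : \sum_(e <- in_star_seq K x) r e * normsq (1 : R[i]) =
      \sum_(e <- in_star_seq K x) r e.
    by apply: eq_bigr => e _; rewrite /normsq /=; ring.
  rewrite ler_wpM2l//; first by rewrite big_seq sumr_ge0.
  have /(L2EE Kweights)[_ uoo] := Lu.
  have := l2sq_sum hr0 uoo (in_star_seq_uniq K x).
  have -> : \sum_(e <- in_star_seq K x) r e * normsq (u e) =
      2 * \sum_(e <- in_star_seq K x) half_r r e * normsq (u e).
    by rewrite mulr_sumr; apply: eq_bigr => e _; rewrite /half_r; field.
  rewrite ler_pM2l// => -> // e /(in_star_seqP Klocfin)[Ke _].
  exact: mem_set.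
- by move=> v Lv; exact: eval_L2V.
Qed.

Lemma normH_sqrt z : L2H K c r z ->
  normH K c r z = (Num.sqrt (sum_sq qV qE z))%:E.
Proof.
case: z => f phi [/= Lf Lphi].
apply: (pair_norm_sqrt (q := qV) (p := qE)).
- exact: hilbert_ge0 hV _.
- exact: hilbert_ge0 hE _.
- exact: (normV_sqrt Kweights).
- exact: (normE_sqrt Kweights).
Qed.

Lemma D_op_L2 : D_op K c r `<=` L2H K c r `*` L2H K c r.
Proof.
move=> _ [[f phi] [/= Cf Cphi] <-]; do 2!split => /=.
- exact: (C00_L2V Kweights).
- exact: (C01_L2E Kweights).
- by apply: (C00_L2V Kweights); exact: (deltaK_C00 _ _ Klocfin).
- by apply: (C01_L2E Kweights); exact: (dK_C01 Klocfin).
Qed.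

Lemma D_barE : D_bar K c r = (L2H K c r `*` L2H K c r) `&`
  adherent (sum_sq (sum_sq qV qE) (sum_sq qV qE)) (D_op K c r).
Proof.
have hH := hilbert_prod hV hE.
apply: (closure_adherent hH hH); [exact: normH_sqrt|exact: normH_sqrt|].
exact: D_op_L2.
Qed.

(** [D_op] sends each component to its own factor, so approximants of [f] and of [phi] can be chosen
    independently, each with half of the error. *)
Lemma D_barP f phi g psi : D_bar K c r ((f, phi), (g, psi)) <->
  d_bar K c r (f, psi) /\ delta_bar K c r (phi, g).
Proof.
rewrite D_barE d_barE// delta_barE//.
have [q0 p0] := (hilbert_ge0 hV, hilbert_ge0 hE).
split.
  move=> [[[/= Lf Lphi] [/= Lg Lpsi]] ad]; split; split=> // e e0.
    have [_ [[u v] [/= Cu Cv] <-] ue] := ad e e0.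
    exists (u, dK K u); first by exists u.
    apply: le_trans ue; rewrite /sum_sq /=.
    have := q0 (deltaK K c r v - g); have := p0 (v - phi); lra.
  have [_ [[u v] [/= Cu Cv] <-] ue] := ad e e0.
  exists (v, deltaK K c r v); first by exists v.
  apply: le_trans ue; rewrite /sum_sq /=.
  have := q0 (u - f); have := p0 (dK K u - psi); lra.
move=> [[[/= Lf Lpsi] adf] [[/= Lphi Lg] adphi]]; split=> // e e0.
have e20 : 0 < e / 2 by rewrite divr_gt0.
have [_ [u Cu <-] ue] := adf _ e20.
have [_ [v Cv <-] ve] := adphi _ e20.
exists ((u, v), (deltaK K c r v, dK K u)); first by exists (u, v).
by move: ue ve; rewrite /sum_sq /=; lra.
Qed.

(** The in-stars partition the oriented edges by terminal vertex. This direction bounds the norm of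
    a differential by a sum over vertices; [esum_in_star_ge] serves for the norm of a divergence. *)
Lemma esum_in_star_le (F : V * V -> R) (G : V -> R) :
    (forall e, edges K e -> 0 <= F e) ->
    (forall x, vertices K x -> \sum_(e <- in_star_seq K x) F e <= G x) ->
  (\esum_(e in edges K) (F e)%:E <= \esum_(x in vertices K) (G x)%:E)%E.
Proof.
move=> F0 FG; apply: esum_EFin_le => s us sK.
pose X := undup [seq e.2 | e <- s].
have XK : {subset X <= vertices K}.
  move=> x; rewrite mem_undup => /mapP[e /sK /set_mem Ke ->].
  by apply: mem_set; case: (edge_vertices Ke).
apply: le_trans (esum_EFin_ge G (undup_uniq _) XK); rewrite lee_fin.
have -> : \sum_(e <- s) F e = \sum_(x <- X) \sum_(e <- s | e.2 == x) F e.
  rewrite (exchange_big_dep xpredT)//= big_seq [RHS]big_seq.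
  apply: eq_bigr => e es; under eq_bigl do rewrite eq_sym.
  rewrite -big_filter (@filter_pred1_uniq _ X) ?undup_uniq ?mem_undup ?map_f//.
  by rewrite big_seq1.
rewrite big_seq [leRHS]big_seq; apply: ler_sum => x /XK /set_mem Kx.
apply: le_trans (FG x Kx); rewrite -big_filter; apply: ler_sum_subseq.
- exact: filter_uniq.
- exact: in_star_seq_uniq.
- move=> e; rewrite mem_filter => /andP[/eqP ex /sK /set_mem Ke].
  exact/(in_star_seqP Klocfin).
- by move=> e /(in_star_seqP Klocfin)[/F0].
Qed.

Lemma esum_in_star_ge (F : V * V -> R) (G : V -> R) :
    (forall e, edges K e -> 0 <= F e) ->
    (forall x, vertices K x -> G x <= \sum_(e <- in_star_seq K x) F e) ->
  (\esum_(x in vertices K) (G x)%:E <= \esum_(e in edges K) (F e)%:E)%E.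
Proof.
move=> F0 GF; apply: esum_EFin_le => s us sK.
pose E := flatten [seq in_star_seq K x | x <- s].
have EP e : e \in E -> edges K e /\ e.2 \in s.
  by move=> /flattenP[_ /mapP[x xs ->] /(in_star_seqP Klocfin)[? ->]].
have uE : uniq E.
  rewrite /E {EP E sK}; elim: s us => //= x s IH /andP[xs us].
  rewrite cat_uniq in_star_seq_uniq IH// andbT; apply/hasPn => e.
  move=> /flattenP[_ /mapP[y ys ->] /(in_star_seqP Klocfin)[_ ey]].
  apply/negP => /(in_star_seqP Klocfin)[_ ex].
  by move: xs; rewrite -ex ey ys.
have EK : {subset E <= edges K} by move=> e /EP[? _]; exact: mem_set.
apply: le_trans (esum_EFin_ge F uE EK); rewrite lee_fin big_flatten big_map.
by rewrite big_seq [leRHS]big_seq; apply: ler_sum => x /sK /set_mem; exact: GF.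
Qed.

End Cutoff.

(** * Cut-off *)

Section ChiCutoff.
Variables (R : realType) (V : choiceType) (K : graph V).
Variables (c : V -> R) (r : V * V -> R).
Hypotheses (Klocfin : locally_finite K) (Kweights : weights K c r).
Implicit Types (f g : V -> R[i]) (phi psi : V * V -> R[i]).

Local Notation qV := (l2sq (vertices K) c).
Local Notation qE := (l2sq (edges K) (half_r r)).
Local Notation sumV := (l2sum (vertices K) c).
Local Notation sumE := (l2sum (edges K) (half_r r)).
Local Notation LV := (L2V K c).
Local Notation LE := (L2E K r).
Let c0 := weightV_gt0 Kweights.
Let r0 := weightE_gt0 Kweights.
Let hr0 := half_r_gt0 Kweights.
Let hV := hilbert_L2V Kweights.
Let hE := hilbert_L2E Kweights.

(** The sets [B n] increase to all vertices, so one of them contains the given finite [s]. Only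
    incoming edges are kept in (iii), which is harmless for nonnegative terms, and [C] does not
    depend on [s]. The order on [R[i]] makes [chi n] equal to its real part. *)
Lemma chi_complete_cutoff : chi_complete K c r ->
  exists2 C : R, 0 <= C & forall s : seq V, {subset s <= vertices K} ->
    exists chi : V -> R,
    [/\ C00 K (fun v => (chi v)%:C%C), forall v, v \in s -> chi v = 1,
        forall v, 0 <= chi v <= 1 &
        forall x, vertices K x ->
          \sum_(e <- in_star_seq K x) r e * (chi e.2 - chi e.1) ^+ 2
            <= C * c x].
Proof.
move=> [B [chi [[finB incB unionB] [chi01 chi1 [C [C0 chiC]]]]]].
exists C; first exact: ltW.
move=> s sK; have [n Bn] : exists n, forall v, v \in s -> B n v.
  have incB' n m : (n <= m)%N -> B n `<=` B m.
    elim: m => [|m IH]; first by rewrite leqn0 => /eqP->.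
    rewrite leq_eqVlt => /orP[/eqP->//|/IH h]; exact: subset_trans h (incB m).
  elim: s sK => [|v s IH] sK; first by exists 0%N.
  have [|n nP] := IH; first by move=> u us; apply: sK; rewrite inE us orbT.
  have : vertices K v by apply/set_mem/sK; rewrite inE eqxx.
  rewrite -unionB => -[m _ Bm]; exists (maxn n m) => u; rewrite inE => /orP[/eqP->|/nP].
    exact: incB' (leq_maxr _ _) _ Bm.
  exact: incB' (leq_maxl _ _) _.
pose h v := complex.Re (chi n v).
have [C00chi chin01] := chi01 n.
have chiE v : chi n v = (h v)%:C%C /\ 0 <= h v <= 1.
  have [Kv|nKv] := pselect (vertices K v).
    have := chin01 v Kv; rewrite /h; case: (chi n v) => a b.
    rewrite !lecE /= => /andP[/andP[/eqP-> ->]] /andP[_ ->].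
    by [].
  by have /(_ v nKv) := C00chi.1; rewrite /h => ->; rewrite /= lexx ler01.
exists h; split.
- by rewrite (_ : (fun _ => _) = chi n)//; apply/funext => v; case: (chiE v).
- by move=> v vs; rewrite /h chi1//; exact: Bn.
- by move=> v; case: (chiE v).
move=> x Kx; have := chiC n x Kx.
rewrite fsbig_finite; last exact: Klocfin.
have starP e : (e \in fset_set [set e | edges K e /\ (e.2 = x \/ e.1 = x)]) =
    `[< edges K e /\ (e.2 = x \/ e.1 = x) >].
  by rewrite in_fset_set; [|exact: Klocfin].
have -> : \sum_(e <- fset_set [set e | edges K e /\ (e.2 = x \/ e.1 = x)])
     (r e)%:C%C * dK K (chi n) e ^+ 2 =
   (\sum_(e <- fset_set [set e | edges K e /\ (e.2 = x \/ e.1 = x)])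
     r e * (h e.2 - h e.1) ^+ 2)%:C%C.
  rewrite rmorph_sum /= big_seq [RHS]big_seq; apply: eq_bigr => e.
  rewrite starP => /asboolP[Ke _]; rewrite dKE//.
  by rewrite (chiE e.2).1 (chiE e.1).1 -rmorphB -rmorphXn -rmorphM.
rewrite -fmorphV -rmorphM /= lecR mulrC ler_pdivrMr ?c0//.
apply: le_trans; apply: ler_sum_subseq.
- exact: in_star_seq_uniq.
- exact: fset_uniq.
- move=> e /(in_star_seqP Klocfin)[Ke ex]; rewrite starP; apply/asboolP.
  by split=> //; left.
move=> e; rewrite starP => /asboolP[Ke _].
by rewrite mulr_ge0 ?sqr_ge0// ltW// r0.
Qed.

Hypothesis Kchi : chi_complete K c r.

(** When f agrees at both ends of [e], [d (chi f)] at [e] equals [d chi] at [e] times [f e.2]. By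
    the cut-off bound its squared norm is at most [C / 2] times that of [g], which is [f] erased on
    [s]. *)
Lemma d_bar_ker f : LV f -> (forall e, edges K e -> f e.2 = f e.1) ->
  d_bar K c r (f, 0).
Proof.
move=> Lf df; have [C C0 cutoff] := chi_complete_cutoff Kchi.
have /L2VE[f0 foo] := Lf.
rewrite d_barE//; split; first by split=> //; exact: linset0 (hilbert_linset hE).
(* The two errors are [d] and [C / 2 * d], together at most [(C + 1) * d = e]. *)
move=> e e0; pose d := e / (C + 1).
have d0 : 0 < d by rewrite divr_gt0// ltr_wpDl.
have [s [us sK] tail] := l2_tail c0 foo d0.
(* Neighbours of [s] are included so that [chi] is constant along every edge ending in [s]. *)
have [|chi [C00chi chi1 chi01 chiC]] :=
    cutoff (s ++ [seq e.1 | v <- s, e <- in_star_seq K v]).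
  move=> v; rewrite mem_cat => /orP[/sK//|].
  move=> /allpairsPdep[u [e' [us' /(in_star_seqP Klocfin)[Ke _] ->]]].
  by apply: mem_set; case: (edge_vertices Ke).
pose f' v := (chi v)%:C%C * f v.
have Cf' : C00 K f'.
  split; first by move=> v nv; rewrite /f' f0// mulr0.
  apply: sub_finite_set C00chi.2 => v /=; apply: contra_neq.
  by rewrite /f' => ->; rewrite mul0r.
exists (f', dK K f'); first by exists f'.
have qd : qV (f' - f) <= d.
  apply: (l2sq_le c0); apply: tail => v vs.
    by rewrite fctE /f' chi1 ?mul1r ?subrr// mem_cat vs.
  have -> : (f' - f) v = (chi v - 1)%:C%C * f v.
    by rewrite fctE /f' rmorphB mulrBl mul1r.
  rewrite normsqM ler_piMl ?normsq_ge0// /normsq /= expr0n addr0.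
  by have /andP[h1 h2] := chi01 v; rewrite expr2; nra.
have pd : qE (dK K f' - 0) <= C / 2 * d.
  pose g v := if v \in s then 0 else f v.
  have gd : (sumV g <= d%:E)%E.
    apply: tail => v; rewrite /g; first by move=> ->.
    by case: ifP; rewrite ?normsq0 ?normsq_ge0.
  apply: (l2sq_le hr0).
  apply: (@le_trans _ _ (\esum_(x in vertices K) (C / 2 * (c x * normsq (g x)))%:E)%E).
    apply: esum_in_star_le => // [e' Ke'|x Kx].
      exact: (wnormsq_ge0 hr0).
    have -> : \sum_(e' <- in_star_seq K x)
          half_r r e' * normsq ((dK K f' - 0) e') =
        (\sum_(e' <- in_star_seq K x) r e' * (chi e'.2 - chi e'.1) ^+ 2) *
        (normsq (g x) / 2).
      rewrite mulr_suml big_seq [RHS]big_seq; apply: eq_bigr => e'.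
      move=> e'x; have [Ke' e'2] := in_star_seqP Klocfin x e' e'x.
      rewrite subr0 dKE// /f' -df// -mulrBl -rmorphB normsqM.
      rewrite /half_r /g e'2; case: ifP => xs; last by rewrite /normsq /=; field.
      rewrite !chi1 ?mem_cat ?xs//.
        by rewrite subrr normsq0 expr0n /=; ring.
      by apply/orP; right; apply/allpairsPdep; exists x, e'.
    have := chiC x Kx; have := normsq_ge0 (g x) => g0 /(ler_wpM2r g0); lra.
  rewrite esum_EFinZ ?divr_ge0//; last by move=> t; exact: (wnormsq_ge0 c0).
  by rewrite [leRHS]EFinM lee_wpmul2l// lee_fin divr_ge0.
apply: le_trans (lerD qd pd) _.
have : (C + 1) * d = e by rewrite /d mulrC divfK// gt_eqF// ltr_wpDl.
have := mulr_ge0 C0 (ltW d0); lra.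
Qed.

(** As [deltaK phi = 0], the divergence of the cut-off form at [x] only sees half the increments of
    [chi] along the edges into [x]. Cauchy-Schwarz separates these increments, bounded by
    [C * c x / 4], from the values of the form. *)
Lemma delta_bar_ker phi : LE phi -> deltaK K c r phi = 0 ->
  delta_bar K c r (phi, 0).
Proof.
move=> Lf df; have [C C0 cutoff] := chi_complete_cutoff Kchi.
have /(L2EE Kweights)[[f0 fN] foo] := Lf.
rewrite delta_barE//; split; first by split=> //; exact: linset0 (hilbert_linset hV).
move=> eps e0; pose d := eps / (C + 1).
have d0 : 0 < d by rewrite divr_gt0// ltr_wpDl.
have [s [us sK] tail] := l2_tail hr0 foo d0.
have [|chi [C00chi chi1 chi01 chiC]] :=
    cutoff ([seq e.1 | e <- s] ++ [seq e.2 | e <- s]).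
  move=> v; rewrite mem_cat => /orP[] /mapP[e' /sK /set_mem Ke ->];
  by apply: mem_set; case: (edge_vertices Ke).
have chi1s e : e \in s -> chi e.1 = 1 /\ chi e.2 = 1.
  by move=> es; split; apply: chi1; rewrite mem_cat map_f ?orbT.
(* The average is symmetric under reversal of [e], which keeps the product odd. *)
pose f' e := ((chi e.1 + chi e.2) / 2)%:C%C * phi e.
have Cf' : C01 K f'.
  split.
    split=> e Ke; rewrite /f'; first by rewrite f0// mulr0.
    by rewrite fN// mulrN [chi _ + _]addrC.
  apply: (finite_support_edges Klocfin C00chi) => e; rewrite /f' => fe; split.
    by apply: contrapT => nKe; move: fe; rewrite f0// mulr0 eqxx.
  have [c2|] := eqVneq (chi e.2) 0; last first.
    by move=> h; left; apply: contra_neq h => -[].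
  right; apply: contra_neq fe => -[c1].
  by rewrite c1 c2 addr0 mul0r mul0r.
exists (f', deltaK K c r f'); first by exists f'.
have qd : qE (f' - phi) <= d.
  apply: (l2sq_le hr0); apply: tail => e es.
    have [h1 h2] := chi1s e es.
    by rewrite fctE /f' h1 h2 divff ?pnatr_eq0// mul1r subrr.
  have -> : (f' - phi) e = ((chi e.1 + chi e.2) / 2 - 1)%:C%C * phi e.
    by rewrite fctE /f' rmorphB mulrBl mul1r.
  rewrite normsqM ler_piMl ?normsq_ge0// /normsq /= expr0n addr0.
  have /andP[h1 h2] := chi01 e.1; have /andP[h3 h4] := chi01 e.2.
  by rewrite expr2; nra.
(* On [s] both ends have [chi = 1], so the increment vanishes and [phi] may be replaced by [g], of
   squared norm at most [d]. *)
pose g e := if e \in s then 0 else phi e.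
have gd : (sumE g <= d%:E)%E.
  apply: tail => e; rewrite /g; first by move=> ->.
  by case: ifP; rewrite ?normsq0 ?normsq_ge0.
have pd : qV (deltaK K c r f' - 0) <= C / 2 * d.
  apply: (l2sq_le c0).
  apply: (@le_trans _ _
      (\esum_(e in edges K) (C / 2 * (half_r r e * normsq (g e)))%:E)%E).
    apply: esum_in_star_ge => // [e Ke|x Kx].
      by rewrite mulr_ge0 ?divr_ge0//; exact: (wnormsq_ge0 hr0).
    have -> : (deltaK K c r f' - 0) x = ((c x)^-1)%:C%C *
        \sum_(e <- in_star_seq K x)
          (r e)%:C%C * ((chi e.1 - chi e.2) / 2)%:C%C * g e.
      (* Subtracting [chi x * deltaK phi x], which is 0, turns the average of [chi] into half of its
         increment along [e]. *)
      rewrite subr0 -[LHS]subr0 -[X in _ - X](mulr0 (chi x)%:C%C).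
      rewrite -[X in _ * X]/((0 : V -> R[i]) x) -df !(deltaKE _ _ Klocfin).
      rewrite mulrCA -mulrBr fmorphV; congr (_ * _).
      rewrite mulr_sumr -sumrB big_seq [RHS]big_seq; apply: eq_bigr => e ex.
      have [Ke <-] := in_star_seqP Klocfin x e ex.
      rewrite /f' /g; case: ifP => es.
        have [-> ->] := chi1s e es.
        by rewrite divff ?pnatr_eq0// !mul1r subrr mulr0.
      have -> : (chi e.1 - chi e.2) / 2 = (chi e.1 + chi e.2) / 2 - chi e.2.
        by field.
      by rewrite rmorphB; ring.
    rewrite normsqM.
    have rs e : e \in in_star_seq K x -> 0 <= r e.
      by move=> /(in_star_seqP Klocfin)[Ke _]; exact/ltW/r0.
    have CS := normsq_CS (fun e => ((chi e.1 - chi e.2) / 2)%:C%C) g rs.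
    have cx := c0 Kx.
    have A1 : \sum_(e <- in_star_seq K x) r e *
        normsq (((chi e.1 - chi e.2) / 2)%:C%C) <= C * c x / 4.
      apply: le_trans (_ : (\sum_(e <- in_star_seq K x)
          r e * (chi e.2 - chi e.1) ^+ 2) / 4 <= _).
        rewrite le_eqVlt; apply/orP; left; apply/eqP; rewrite mulr_suml.
        by apply: eq_bigr => e _; rewrite /normsq /=; field.
      by rewrite ler_wpM2r// chiC.
    have S0 : 0 <= \sum_(e <- in_star_seq K x) r e * normsq (g e).
      by rewrite big_seq; apply: sumr_ge0 => e /rs ?; rewrite mulr_ge0 ?normsq_ge0.
    have CSA := le_trans CS (ler_wpM2r S0 A1).
    have -> : normsq (((c x)^-1)%:C%C : R[i]) = (c x)^-1 ^+ 2.
      by rewrite /normsq /=; ring.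
    (* One factor [c x] comes from the vertex norm and one from the cut-off bound; they cancel the
       square of [1 / c x]. What is left is [C / 4] for the weights [r], that is [C / 2] for
       [half_r]. *)
    have cx2 : 0 <= c x * (c x)^-1 ^+ 2 by rewrite mulr_ge0 ?sqr_ge0// ltW.
    rewrite [leLHS]mulrA; apply: le_trans (ler_wpM2l cx2 CSA) _.
    rewrite le_eqVlt; apply/orP; left; apply/eqP.
    rewrite [RHS](_ : _ = C / 4 * \sum_(e <- in_star_seq K x) r e * normsq (g e)).
      by field; rewrite gt_eqF.
    by rewrite mulr_sumr; apply: eq_bigr => e _; rewrite /half_r; field.
  rewrite esum_EFinZ ?divr_ge0//; last by move=> t; exact: (wnormsq_ge0 hr0).
  by rewrite [leRHS]EFinM lee_wpmul2l// lee_fin divr_ge0.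
apply: le_trans (lerD qd pd) _.
have : (C + 1) * d = eps by rewrite /d mulrC divfK// gt_eqF// ltr_wpDl.
have := mulr_ge0 C0 (ltW d0); lra.
Qed.

End ChiCutoff.

(** * Orthogonality *)

Section Hodge.
Variables (R : realType) (V : choiceType) (K : graph V).
Variables (c : V -> R) (r : V * V -> R).
Hypotheses (Klocfin : locally_finite K) (Kweights : weights K c r).
Implicit Types (f g : V -> R[i]) (phi psi : V * V -> R[i]).

Local Notation LE := (L2E K r).
Let c0 := weightV_gt0 Kweights.

Definition vertex_delta (v : V) : V -> R[i] := fun u => (u == v)%:R.

Definition edge_delta (e : V * V) : V * V -> R[i] :=
  fun e' => (e' == e)%:R - (e' == opp_edge e)%:R.

Lemma opp_edge_neq e : edges K e -> opp_edge e != e.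
Proof.
case: e => x y Kxy; apply/eqP => -[xy _].
by move: Kxy; rewrite xy; exact: edges_loopless.
Qed.

Lemma vertex_delta_C00 v : vertices K v -> C00 K (vertex_delta v).
Proof.
move=> Kv; split.
  by move=> u nu; rewrite /vertex_delta; case: eqP => // uv; case: nu; rewrite uv.
apply: sub_finite_set (finite_set1 v) => u /=; rewrite /vertex_delta.
by have [->//|_] := eqVneq u v; rewrite eqxx.
Qed.

Lemma edge_delta_C01 e : edges K e -> C01 K (edge_delta e).
Proof.
move=> Ke; split; first split.
- move=> e' ne'; rewrite /edge_delta.
  case: eqP => [ee|_]; first by case: ne'; rewrite ee.
  case: eqP => [ee|_]; first by case: ne'; rewrite ee; exact: opp_edge_edges.
  by rewrite subrr.
- move=> e' _; rewrite /edge_delta opprB (can2_eq (@opp_edgeK V) (@opp_edgeK V)).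
  by rewrite (inj_eq (can_inj (@opp_edgeK V))).
apply: (@sub_finite_set _ _ [set e; opp_edge e]); last exact: finite_set2.
move=> e' /=; rewrite /edge_delta.
have [->|_] := eqVneq e' e; first by left.
by have [->|_] := eqVneq e' (opp_edge e); [right|rewrite subrr eqxx].
Qed.

(** Rewrites a star sum over a fixed finite set of vertices, so that double sums over [W] can be
    exchanged. *)
Lemma sum_in_star x (W : seq V) (F : V * V -> R[i]) : uniq W ->
    (forall e, ~ edges K e -> F e = 0) -> 
    (forall e, edges K e -> e.2 = x -> F e != 0 -> e.1 \in W) ->
  \sum_(e <- in_star_seq K x) F e = \sum_(y <- W) F (y, x).
Proof.
move=> uW F0 FW.
have -> : \sum_(y <- W) F (y, x) = \sum_(e <- [seq (y, x) | y <- W]) F e.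
  by rewrite big_map.
rewrite (bigID (fun e => e.1 \in W))/= [X in _ + X]big_seq_cond.
rewrite [X in _ + X]big1 ?addr0; last first.
  by move=> e /andP[/(in_star_seqP Klocfin)[Ke ex]]; apply: contraNeq; exact: FW.
rewrite [RHS](bigID (fun e => e \in edges K))/= [X in _ = _ + X]big1 ?addr0; last first.
  by move=> e /negP nKe; apply: F0 => Ke; apply: nKe; exact: mem_set.
rewrite -big_filter -[RHS]big_filter; apply: perm_big; apply: uniq_perm.
- by rewrite filter_uniq// in_star_seq_uniq.
- by rewrite filter_uniq// map_inj_uniq// => y y' [].
move=> [y z]; rewrite !mem_filter /=; apply/andP/andP.
  move=> [yW /(in_star_seqP Klocfin)[Ke /= zx]]; rewrite zx in Ke *.
  by split; [exact: mem_set|apply/mapP; exists y].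
move=> [/set_mem Ke /mapP[y' y'W [yy' zx]]]; rewrite yy' zx in Ke *.
by split=> //; apply/(in_star_seqP Klocfin).
Qed.

(** Discrete Green's formula: exchanging the summations in the half with [g y] and using
    antisymmetry of [theta] reproduces the other half. *)
Lemma antisym_green (W : seq V) (theta : V -> V -> R[i]) g :
    (forall x y, theta y x = - theta x y) ->
  \sum_(x <- W) \sum_(y <- W) theta y x * (g x - g y) =
  2 * \sum_(x <- W) g x * \sum_(y <- W) theta y x.
Proof.
move=> thN; set S := (X in _ = 2 * X).
have SE : S = \sum_(x <- W) \sum_(y <- W) theta y x * g x.
  by apply: eq_bigr => x _; rewrite mulr_sumr; apply: eq_bigr => y _; rewrite mulrC.
under eq_bigr => x _ do (under eq_bigr => y _ do rewrite mulrBr; rewrite sumrB).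
rewrite sumrB -SE [X in _ - X]exchange_big/=.
have -> : \sum_(j <- W) \sum_(i <- W) theta j i * g j = - S.
  rewrite SE -sumrN; apply: eq_bigr => x _; rewrite -sumrN; apply: eq_bigr => y _.
  by rewrite thN mulNr.
by ring.
Qed.

Lemma conj_realc (a : R) : (a%:C%C)^* = a%:C%C :> R[i].
Proof. by apply/eqP; rewrite eq_complex /= oppr0 !eqxx. Qed.

(** Green's formula on the set [W] of end points of the support, with [theta] the conjugate of
    [r * phi]: the side with differences of [f] vanishes edge by edge, and the other side is twice
    the sum in question. *)
Lemma deltaK_orthogonal f phi : (forall e, edges K e -> f e.2 = f e.1) ->
    C01 K phi ->
  exists s, [/\ uniq s, {subset s <= vertices K},
    forall v, v \notin s -> deltaK K c r phi v = 0 &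
    \sum_(v <- s) (c v)%:C%C * f v * (deltaK K c r phi v)^* = 0].
Proof.
move=> df [[phi0 phiN] phif].
pose s := fset_set [set e | phi e != 0].
have sP e : (e \in s) = (phi e != 0).
  by rewrite /s in_fset_set//; apply/idP/idP => [/set_mem|/mem_set].
pose W := undup ([seq e.1 | e <- s] ++ [seq e.2 | e <- s]).
have sK e : e \in s -> edges K e.
  by rewrite sP => pe; apply: contrapT => nKe; move: pe; rewrite phi0// eqxx.
have WE x : deltaK K c r phi x =
    (c x)^-1%:C%C * \sum_(y <- W) (r (y, x))%:C%C * phi (y, x).
  rewrite (deltaKE _ _ Klocfin) fmorphV; congr (_ * _).
  apply: sum_in_star => [|e nKe|e]; first exact: undup_uniq.
    by rewrite phi0// mulr0.
  move=> Ke _ pe; rewrite mem_undup mem_cat map_f// sP.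
  by apply: contra_neq pe => ->; rewrite mulr0.
exists W; split.
- exact: undup_uniq.
- move=> x; rewrite mem_undup mem_cat => /orP[] /mapP[e /sK Ke ->];
  by apply: mem_set; case: (edge_vertices Ke).
- move=> x xW; rewrite WE big1 ?mulr0// => y _.
  have [->|pe] := eqVneq (phi (y, x)) 0; first by rewrite mulr0.
  case/negP: xW; rewrite mem_undup mem_cat; apply/orP; right.
  by apply/mapP; exists (y, x); rewrite ?sP.
pose theta y x := ((r (y, x))%:C%C * phi (y, x))^*.
have th0 x y : theta y x * (f x - f y) = 0.
  have [Ke|nKe] := pselect (edges K (y, x)).
    by rewrite (df _ Ke) subrr mulr0.
  by rewrite /theta phi0// mulr0 conjC0 mul0r.
have thN x y : theta y x = - theta x y.
  rewrite /theta; have [Ke|nKe] := pselect (edges K (x, y)).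
    have := phiN _ Ke; rewrite /opp_edge /= => ->.
    by rewrite (weightE_sym Kweights Ke) mulrN rmorphN.
  rewrite [phi (x, y)]phi0// [phi (y, x)]phi0 ?mulr0 ?conjC0 ?oppr0// => Ke.
  by apply: nKe; exact: edges_sym.
have := antisym_green W f thN.
rewrite big1; last by move=> x _; rewrite big1// => y _; exact: th0.
move=> /esym/eqP; rewrite mulf_eq0 pnatr_eq0/= => /eqP g0; rewrite -[RHS]g0.
rewrite big_seq [RHS]big_seq; apply: eq_bigr => x.
rewrite mem_undup mem_cat => xW.
have Kx : vertices K x.
  by move: xW => /orP[] /mapP[e /sK Ke ->]; case: (edge_vertices Ke).
rewrite WE rmorphM rmorph_sum /= conj_realc mulrA; congr (_ * _).
rewrite mulrAC -rmorphM /= divff ?gt_eqF ?c0//.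
by rewrite mul1r.
Qed.

Lemma dK_orthogonal f psi : LE psi -> deltaK K c r psi = 0 -> C00 K f ->
  exists s, [/\ uniq s, {subset s <= edges K},
    forall e, e \notin s -> dK K f e = 0 &
    \sum_(e <- s) (r e)%:C%C * psi e * (dK K f e)^* = 0].
Proof.
move=> [[psi0 psiN] _] dpsi [f0 ff].
pose s := fset_set [set v | f v != 0].
have sP v : (v \in s) = (f v != 0).
  by rewrite /s in_fset_set//; apply/idP/idP => [/set_mem|/mem_set].
(* With the neighbours of the support included, the sum over [W] at a vertex with [f x != 0] runs
   over its whole star, and is 0 because [deltaK psi x = 0]. *)
pose W := undup (s ++ [seq e.1 | v <- s, e <- in_star_seq K v]).
have sW v : v \in s -> v \in W by rewrite mem_undup mem_cat => ->.
have nW e : edges K e -> e.2 \in s -> e.1 \in W.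
  move=> Ke es; rewrite mem_undup mem_cat; apply/orP; right.
  by apply/allpairsPdep; exists e.2, e; split=> //; apply/(in_star_seqP Klocfin).
exists [seq e <- [seq (y, x) | x <- W, y <- W] | e \in edges K]; split.
- by rewrite filter_uniq// allpairs_uniq ?undup_uniq// => -[? ?] [? ?] _ _ [-> ->].
- by move=> e; rewrite mem_filter => /andP[].
- move=> e; have [Ke|nKe] := pselect (edges K e); last by rewrite dK_nonedge.
  apply: contraNeq; rewrite dKE// => de.
  rewrite mem_filter mem_set//=; case: e Ke de => y x Ke /= de.
  have [xs|xs] := boolP (x \in s).
    by apply: allpairs_f; [exact: sW|exact: nW Ke xs].
  have ys : y \in s.
    rewrite sP; apply: contra_neq de => ->.
    by move: xs; rewrite sP negbK => /eqP ->; rewrite subrr.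
  by apply: allpairs_f; [exact: nW (edges_sym Ke) ys|exact: sW].
pose theta y x := (r (y, x))%:C%C * psi (y, x).
have thN x y : theta y x = - theta x y.
  rewrite /theta; have [Ke|nKe] := pselect (edges K (x, y)).
    have := psiN _ Ke; rewrite /opp_edge /= => ->.
    by rewrite (weightE_sym Kweights Ke) mulrN.
  rewrite [psi (x, y)]psi0// [psi (y, x)]psi0 ?mulr0 ?oppr0// => Ke.
  by apply: nKe; exact: edges_sym.
rewrite big_filter big_mkcond big_allpairs_dep/=.
transitivity (\sum_(x <- W) \sum_(y <- W) theta y x * ((f x)^* - (f y)^*)).
  apply: eq_bigr => x _; apply: eq_bigr => y _; rewrite /theta.
  have [Ke|nKe] := pselect (edges K (y, x)).
    by rewrite mem_set// dKE//= rmorphB.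
  by rewrite memNset// psi0// mulr0 mul0r.
rewrite (antisym_green W (fun x => (f x)^*) thN) big1 ?mulr0// => x _.
have [->|fx] := eqVneq (f x) 0; first by rewrite conjC0 mul0r.
have Kx : vertices K x.
  by apply: contrapT => nKx; move: fx; rewrite f0// eqxx.
have := congr1 (fun h => h x) dpsi; rewrite /= (deltaKE _ _ Klocfin).
move=> /eqP; rewrite mulf_eq0 invr_eq0 -[0]/(0%:C%C) => /orP[/eqP[cx]|/eqP h].
  by have := c0 Kx; rewrite cx ltxx.
rewrite -(sum_in_star (x := x) (F := fun e => (r e)%:C%C * psi e)) ?undup_uniq//.
- by rewrite h mulr0.
- by move=> e nKe; rewrite psi0// mulr0.
- by move=> e Ke ex _; apply: nW => //; rewrite ex sP.
Qed.

End Hodge.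

(** * Orthogonality to the ranges, and orthogonality of kernels and ranges *)

Section HodgeDecomposition.
Variables (R : realType) (V : choiceType) (K : graph V).
Variables (c : V -> R) (r : V * V -> R).
Hypotheses (Klocfin : locally_finite K) (Kweights : weights K c r).
Implicit Types (f g : V -> R[i]) (phi psi : V * V -> R[i]).

Local Notation qV := (l2sq (vertices K) c).
Local Notation qE := (l2sq (edges K) (half_r r)).
Local Notation sumE := (l2sum (edges K) (half_r r)).
Local Notation LV := (L2V K c).
Local Notation LE := (L2E K r).
Let c0 := weightV_gt0 Kweights.
Let r0 := weightE_gt0 Kweights.
Let hr0 := half_r_gt0 Kweights.
Let hV := hilbert_L2V Kweights.
Let hE := hilbert_L2E Kweights.

Lemma edge_ends_neq e : edges K e -> e.1 != e.2.
Proof.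
case: e => x y Kxy; apply/eqP => /= xy; move: Kxy; rewrite xy.
exact: edges_loopless.
Qed.

Lemma sum_mulr_eq (T : eqType) (s : seq T) (F : T -> R[i]) a : uniq s ->
  \sum_(t <- s) F t * (t == a)%:R = F a * (a \in s)%:R.
Proof.
move=> us; have [as_|as_] := boolP (a \in s); last first.
  rewrite mulr0 big_seq big1// => t ts; case: eqP => [ta|_]; last by rewrite mulr0.
  by move: as_; rewrite -ta ts.
rewrite (bigD1_seq a)//= eqxx big1 ?addr0// => t /negbTE ->.
by rewrite mulr0.
Qed.

Lemma deltaK_edge_delta e x : edges K e ->
  deltaK K c r (edge_delta R e) x =
   (c x)^-1%:C%C * (r e)%:C%C * ((x == e.2)%:R - (x == e.1)%:R).
Proof.
move=> Ke; rewrite (deltaKE _ _ Klocfin) fmorphV -mulrA; congr (_ * _).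
under eq_bigr do rewrite mulrBr.
rewrite sumrB !sum_mulr_eq ?in_star_seq_uniq// mulrBr.
have inE' e' : edges K e' -> (e' \in in_star_seq K x) = (x == e'.2).
  move=> Ke'; apply/(in_star_seqP Klocfin)/eqP; first by case=> _ ->.
  by move=> ->.
rewrite !inE'//; last exact: opp_edge_edges.
congr (_ - _ * _); case: e Ke => y z Ke.
by rewrite /opp_edge /= (weightE_sym Kweights Ke).
Qed.

Lemma l2sum_half_r phi : (l2sum (edges K) r phi = 2%:E * sumE phi)%E.
Proof.
rewrite /l2sum -esum_EFinZ//; last by move=> e; exact: (wnormsq_ge0 hr0).
by apply: eq_esum => e _; congr (_%:E); rewrite /half_r; field.
Qed.

Lemma innerV_ker_range f g : op_ker (d_bar K c r) f -> (delta_bar K c r).`2 g ->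
  innerV K c f g = 0.
Proof.
move=> kf [phi dphi].
have [/L2VE[_ foo] _] := d_bar_L2 Klocfin Kweights kf.
have [_ Lg] := delta_bar_L2 Klocfin Kweights dphi.
have /L2VE[_ goo] := Lg.
apply: (l2_inner_eq0 c0) => // e e0.
have := dphi; rewrite delta_barE// => -[_ /(_ e e0)[_ [psi Cpsi <-] he]].
have Ld : LV (deltaK K c r psi) by apply: (C00_L2V Kweights); exact: (deltaK_C00 _ _ Klocfin).
exists (deltaK K c r psi).
  apply: (l2sum_le c0).
    by have /L2VE[] := linsetB (hilbert_linset hV) Ld Lg.
  by apply: le_trans he; rewrite /sum_sq lerDr (hilbert_ge0 hE).
apply: deltaK_orthogonal => // e' Ke'; apply/eqP; rewrite -subr_eq0 -(dKE _ Ke').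
by rewrite -(d_bar_dK Klocfin Kweights kf).
Qed.

Lemma innerE_ker_range phi psi :
  op_ker (delta_bar K c r) phi -> (d_bar K c r).`2 psi -> innerE K r phi psi = 0.
Proof.
move=> kphi [f df].
have [Lphi _] := delta_bar_L2 Klocfin Kweights kphi.
have [_ Lpsi] := d_bar_L2 Klocfin Kweights df.
have /(L2EE Kweights)[_ phioo] := Lphi.
have /(L2EE Kweights)[_ psioo] := Lpsi.
have two_lt x : (sumE x < +oo)%E -> (l2sum (edges K) r x < +oo)%E.
  by move=> /(l2sumE hr0) xE; rewrite l2sum_half_r xE -EFinM ltry.
rewrite /innerE (l2_inner_eq0 r0) ?mulr0//; try exact: two_lt.
(* The inner product sums with weight [r] while [qE] uses [r / 2], so an approximation within
   [e / 2] is required. *)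
move=> e e0; have e20 : 0 < e / 2 by rewrite divr_gt0.
have := df; rewrite d_barE// => -[_ /(_ _ e20)[_ [g Cg <-] he]].
have Ld : LE (dK K g) by apply: (C01_L2E Kweights); exact: (dK_C01 Klocfin).
exists (dK K g).
  have /(L2EE Kweights)[_ oo] := linsetB (hilbert_linset hE) Ld Lpsi.
  rewrite l2sum_half_r (l2sumE hr0 oo) -EFinM lee_fin.
  have := hilbert_ge0 hV (g - f); move: he; rewrite /sum_sq /=; lra.
apply: (dK_orthogonal Klocfin Kweights) => //.
by rewrite -(delta_bar_deltaK Klocfin Kweights kphi).
Qed.

(** The test form is the differential of the indicator of [v]: 1 on edges into [v], -1 on the
    reversed ones. By oddness of [phi] the two halves contribute equally, which undoes the factor
    1/2 and leaves the star sum at [v]. *)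
Lemma range_d_perp phi : LE phi ->
    (forall psi, (d_bar K c r).`2 psi -> qE phi <= qE (phi - psi)) ->
  deltaK K c r phi = 0.
Proof.
move=> Lphi min; apply/funext => v.
have [Kv|nKv] := pselect (vertices K v); last exact: deltaK_nonvertex.
have /(L2EE Kweights)[[phi0 phiN] phioo] := Lphi.
have Cv := vertex_delta_C00 R Kv.
pose s := in_star_seq K v ++ [seq opp_edge e | e <- in_star_seq K v].
have inP := in_star_seqP Klocfin v.
have us : uniq s.
  rewrite cat_uniq in_star_seq_uniq (map_inj_uniq (can_inj (@opp_edgeK V))).
  rewrite in_star_seq_uniq andbT; apply/hasPn => _ /mapP[e /inP[Ke ev] ->].
  by apply/negP => /inP[_ /= ev']; have := edge_ends_neq Ke; rewrite ev ev' eqxx.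
have dE e : e \in in_star_seq K v ->
    dK K (vertex_delta R v) e = 1 /\ dK K (vertex_delta R v) (opp_edge e) = -1.
  move=> /inP[Ke ev]; have Ke' := opp_edge_edges Ke.
  have e1 : e.1 != v by rewrite -ev edge_ends_neq.
  by rewrite !dKE//= /vertex_delta ev eqxx (negbTE e1) subr0 sub0r.
have : \sum_(e <- s) (half_r r e)%:C%C * phi e * (dK K (vertex_delta R v) e)^* = 0.
  apply: (l2_minimal_orthogonal hr0 phioo us).
  - move=> e; rewrite mem_cat => /orP[/inP[Ke _]|/mapP[e' /inP[Ke' _] ->]].
      exact: mem_set.
    by apply: mem_set; exact: opp_edge_edges.
  - move=> e es; have [Ke|nKe] := pselect (edges K e); last exact: dK_nonedge.
    rewrite dKE// /vertex_delta.
    have [e2|_] := eqVneq e.2 v.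
      by case/negP: es; rewrite mem_cat; apply/orP; left; exact/inP.
    have [e1|_] := eqVneq e.1 v; last by rewrite subrr.
    case/negP: es; rewrite mem_cat; apply/orP; right; apply/mapP.
    exists (opp_edge e); last by rewrite opp_edgeK.
    by apply/inP; split=> //; exact: opp_edge_edges.
  move=> a; apply: min; exists (a *: vertex_delta R v).
  have := linsetZ (linset_d_bar Klocfin Kweights) a (d_op_bar Klocfin Kweights Cv).
  exact.
rewrite big_cat big_map /= -big_split /= (deltaKE _ _ Klocfin) => h.
rewrite [X in _ * X](_ : _ = 0) ?mulr0//; rewrite -[RHS]h.
rewrite big_seq [RHS]big_seq; apply: eq_bigr => e ein.
have [-> ->] := dE e ein; have [Ke _] := inP e ein.
rewrite phiN//; case: e Ke {ein} => x y Ke.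
rewrite /half_r /opp_edge /= (weightE_sym Kweights Ke) rmorphN conjC1.
have -> : (r (x, y))%:C%C = (r (x, y) / 2)%:C%C + (r (x, y) / 2)%:C%C :> R[i].
  by rewrite -rmorphD; congr (_%:C)%C; field.
by ring.
Qed.

(** The divergence of [edge_delta] lives on the two ends of [e] with values [r e / c] up to sign;
    the weights [c] cancel in the pairing and leave [r e] times the difference of [f]. *)
Lemma range_delta_perp f : LV f ->
    (forall g, (delta_bar K c r).`2 g -> qV f <= qV (f - g)) ->
  forall e, edges K e -> f e.2 = f e.1.
Proof.
move=> Lf min e Ke; have /L2VE[f0 foo] := Lf.
have Ce := edge_delta_C01 R Ke.
have [K1 K2] := edge_vertices Ke.
have e12 := edge_ends_neq Ke.
have us : uniq [:: e.1; e.2] by rewrite /= inE e12.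
have sumE1 x := deltaK_edge_delta x Ke.
have : \sum_(v <- [:: e.1; e.2])
    (c v)%:C%C * f v * (deltaK K c r (edge_delta R e) v)^* = 0.
  apply: (l2_minimal_orthogonal c0 foo us).
  - by move=> x; rewrite !inE => /orP[] /eqP->; rewrite ?inE.
  - move=> x; rewrite !inE negb_or sumE1 => /andP[/negbTE-> /negbTE->].
    by rewrite subrr mulr0.
  move=> a; apply: min; exists (a *: edge_delta R e).
  have := linsetZ (linset_delta_bar Klocfin Kweights) a (delta_op_bar Klocfin Kweights Ce).
  exact.
rewrite !big_cons big_nil addr0 !sumE1 !eqxx (negbTE e12) [e.2 == _]eq_sym (negbTE e12).
rewrite /= subr0 sub0r mulr1 mulrN1 rmorphN !rmorphM /= !conj_realc.
have cancel x : vertices K x -> (c x)%:C%C * (c x)^-1%:C%C = 1 :> R[i].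
  by move=> /c0 cx; rewrite -rmorphM divff ?gt_eqF.
have re : (r e)%:C%C != 0 :> R[i].
  by apply/eqP => -[re]; have := r0 Ke; rewrite re ltxx.
move=> h; apply/eqP; rewrite -subr_eq0; apply/eqP/(mulfI re); rewrite mulr0 -[RHS]h.
transitivity ((c e.1)%:C%C * (c e.1)^-1%:C%C * ((r e)%:C%C * - f e.1) +
  (c e.2)%:C%C * (c e.2)^-1%:C%C * ((r e)%:C%C * f e.2)).
  by rewrite !cancel//; ring.
by ring.
Qed.

End HodgeDecomposition.

(** * Closed range *)

Section ClosedRange.
Variables (R : realType) (V : choiceType) (K : graph V).
Variables (c : V -> R) (r : V * V -> R).
Hypotheses (Klocfin : locally_finite K) (Kweights : weights K c r).
Implicit Types (f g : V -> R[i]) (phi psi : V * V -> R[i]).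

Local Notation qV := (l2sq (vertices K) c).
Local Notation qE := (l2sq (edges K) (half_r r)).
Local Notation LV := (L2V K c).
Local Notation LE := (L2E K r).
Let c0 := weightV_gt0 Kweights.
Let hr0 := half_r_gt0 Kweights.
Let hV := hilbert_L2V Kweights.
Let hE := hilbert_L2E Kweights.

Lemma weights_subgraph (K' : graph V) : subgraph K' K -> weights K' c r.
Proof.
by move=> [VK EK]; case: Kweights => cp rp rs; split=> [v /VK|e /EK|e /EK]; auto.
Qed.

Lemma l2_subset (T : choiceType) (S S' : set T) (w : T -> R) (x : T -> R[i]) :
    S' `<=` S -> (forall t, S t -> 0 < w t) -> (forall t, ~ S' t -> x t = 0) ->
  l2sum S' w x = l2sum S w x.
Proof.
move=> SS w0 x0; rewrite /l2sum [LHS]esum_mkcond [RHS]esum_mkcond.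
apply: eq_esum => t _; have [S't|nS't] := pselect (S' t).
  by rewrite !mem_set//; exact: SS.
by rewrite (memNset nS't) x0// normsq0 mulr0 if_same.
Qed.

Variable K0 : graph V.
Hypotheses (K0sub : subgraph K0 K) (K0fin : finite_graph K0).
Local Notation Kc := (complementary_graph K K0).

Lemma compl_subgraph : subgraph Kc K.
Proof. by split; [move=> v []|move=> e [[]]]. Qed.

Lemma L2V_compl f : LV f -> vanishing_on (fset_set (vertices K0)) f ->
  L2V Kc c f /\ normV Kc c f = normV K c f.
Proof.
move=> /L2VE[f0 foo] fv.
have f0c v : ~ vertices Kc v -> f v = 0.
  move=> nv; have [Kv|] := pselect (vertices K v); last exact: f0.
  apply: fv; rewrite in_fset_set; last by case: K0fin.
  by apply: mem_set; apply: contrapT => nK0; exact: nv.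
have E := l2_subset compl_subgraph.1 c0 f0c.
by split; [apply/L2VE; split=> //; rewrite E|rewrite !normV_l2sum E].
Qed.

(** An edge missing from the complement lies in [K0] or has an end in [K0]; local finiteness bounds
    the second kind. *)
Lemma finite_edges_compl : finite_set (edges K `\` edges Kc).
Proof.
have [finV finE] := K0fin.
apply: (@sub_finite_set _ _ (edges K0 `|` \bigcup_(v in vertices K0)
    [set e | edges K e /\ (e.2 = v \/ e.1 = v)])).
  move=> e [Ke nKc].
  have [|nK0] := pselect (edges K0 e); [by left|right].
  have [K1 K2] := edge_vertices Ke.
  have [|n2] := pselect (vertices K0 e.2).
    by exists e.2 => //; split=> //; left.
  have [|n1] := pselect (vertices K0 e.1).
    by exists e.1 => //; split=> //; right.
  by case: nKc; split.
rewrite finite_setU; split=> //; apply: bigcup_finite => // v /K0sub.1.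
exact: Klocfin.
Qed.

Lemma L2E_compl phi : LE phi ->
    vanishing_on (fset_set (edges K `\` edges Kc)) phi ->
  L2E Kc r phi /\ normE Kc r phi = normE K r phi.
Proof.
move=> /(L2EE Kweights)[[p0 pN] poo] pv.
have p0c e : ~ edges Kc e -> phi e = 0.
  move=> ne; have [Ke|] := pselect (edges K e); last exact: p0.
  by apply: pv; rewrite in_fset_set; [exact: mem_set|exact: finite_edges_compl].
have wc := weights_subgraph compl_subgraph.
have E := l2_subset compl_subgraph.2 hr0 p0c.
split; last by rewrite (normE_l2sum wc) (normE_l2sum Kweights) E.
apply/(L2EE wc); split; last by rewrite E.
by split=> // e /compl_subgraph.2; exact: pN.
Qed.

Variable C : R.
Hypothesis C0 : 0 < C.
Hypothesis KcC : forall h k, L2H Kc c r h -> D_bar K c r (h, k) ->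
  (normH K c r h <= C%:E * normH K c r k)%E.

(** Positivity at infinity in squared form, on elements whose vanishing conditions place them in the
    complementary graph. It is used with one of the two graph pairs equal to [(0, 0)], giving a
    bound for the other operator alone. *)
Lemma compl_bound f phi g psi :
    d_bar K c r (f, psi) -> delta_bar K c r (phi, g) ->
    vanishing_on (fset_set (vertices K0)) f ->
    vanishing_on (fset_set (edges K `\` edges Kc)) phi ->
  qV f + qE phi <= C ^+ 2 * (qV g + qE psi).
Proof.
move=> df dphi fv pv.
have [/= Lf Lpsi] := d_bar_L2 Klocfin Kweights df.
have [/= Lphi Lg] := delta_bar_L2 Klocfin Kweights dphi.
have := KcC (h := (f, phi)) (k := (g, psi)).
rewrite !normH_sqrt// -EFinM lee_fin => /(_ _ _).
have q0 := hilbert_ge0 (hilbert_prod hV hE).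
have h1 : L2H Kc c r (f, phi).
  by split; [case: (L2V_compl Lf fv)|case: (L2E_compl Lphi pv)].
have h2 : D_bar K c r ((f, phi), (g, psi)) by apply/D_barP.
move=> /(_ h1 h2); rewrite -ler_sqr ?nnegrE ?sqrtr_ge0//; last first.
  by rewrite mulr_ge0 ?sqrtr_ge0// ltW.
by rewrite exprMn !sqr_sqrtr.
Qed.

Lemma range_d_bar_closed :
  LE `&` adherent qE (d_bar K c r).`2 `<=` (d_bar K c r).`2.
Proof.
have sd := linset_d_bar Klocfin Kweights.
have dL := d_bar_L2 Klocfin Kweights.
apply: (closed_range_vanish (s := fset_set (vertices K0)) hE sd dL).
  (* Subtracting [z.1 v] times the indicator of [v] clears this coordinate and leaves those in [s]
     alone. If [v] is no vertex or already lies in [s], the coordinate is 0 and [b = 0] serves. *)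
  move=> v s; have [[Kv vs]|nv] := pselect (vertices K v /\ v \notin s).
    exists (vertex_delta R v, dK K (vertex_delta R v)).
      split; first exact: (d_op_bar Klocfin Kweights (vertex_delta_C00 R Kv)).
      by move=> u us /=; rewrite /vertex_delta; case: eqP => // uv; move: vs; rewrite -uv us.
    move=> z Az z0; exists (z.1 v) => u; rewrite inE.
    rewrite -[(z.1 - _) u]/(z.1 u - z.1 v * (u == v)%:R).
    have [->|_] := eqVneq u v; first by rewrite mulr1 subrr.
    by move=> /z0 ->; rewrite mulr0 subrr.
  exists 0; first by split; [exact: linset0|].
  move=> z Az z0; exists 0 => u; rewrite scaler0 subr0 inE => /orP[/eqP->|/z0//].
  have [vs|vs] := boolP (v \in s); first exact: z0.
  have [Kv|nKv] := pselect (vertices K v); first by case: nv.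
  by case: (dL _ Az) => -[+ _] _; apply.
apply: (closed_range (C := C ^+ 2) hV hE).
- exact: linset_vanishing.
- by move=> z [/dL].
- apply: (closed_vanishing hV hE dL (d_bar_closed Klocfin Kweights)) => v _.
  have [Kv|nKv] := pselect (vertices K v).
    by exists (c v)^-1 => u Lu; exact: eval_L2V.
  by exists 0 => u [u0 _]; rewrite u0// normsq0 mul0r.
move=> [f psi] [df fv] /=.
have d0 := linset0 (linset_delta_bar Klocfin Kweights).
have v0 : vanishing_on (fset_set (edges K `\` edges Kc)) (0 : V * V -> R[i]) by [].
have := compl_bound df d0 fv v0.
by rewrite (hilbert0 hE) (hilbert0 hV) addr0 add0r.
Qed.

Lemma range_delta_bar_closed :
  LV `&` adherent qV (delta_bar K c r).`2 `<=` (delta_bar K c r).`2.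
Proof.
have sd := linset_delta_bar Klocfin Kweights.
have dL := delta_bar_L2 Klocfin Kweights.
apply: (closed_range_vanish (s := fset_set (edges K `\` edges Kc)) hV sd dL).
  move=> e s.
  (* The coordinates at [e] and [-e] are tied by oddness: as soon as one of them lies in [s], the
     form already vanishes at [e] and nothing is released. *)
  have [[Ke [es es']]|ne] :=
      pselect (edges K e /\ e \notin s /\ opp_edge e \notin s).
    exists (edge_delta R e, deltaK K c r (edge_delta R e)).
      split; first exact: (delta_op_bar Klocfin Kweights (edge_delta_C01 R Ke)).
      move=> u us /=; rewrite /edge_delta.
      have [ue|_] := eqVneq u e; first by move: es; rewrite -ue us.
      have [ue|_] := eqVneq u (opp_edge e); first by move: es'; rewrite -ue us.
      by rewrite subrr.
    move=> z Az z0; exists (z.1 e) => u; rewrite inE.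
    rewrite -[(z.1 - _) u]/(z.1 u - z.1 e * ((u == e)%:R - (u == opp_edge e)%:R)).
    have [-> _|ue /=] := eqVneq u e.
      by rewrite eq_sym (negbTE (opp_edge_neq Ke)) subr0 mulr1 subrr.
    move=> us; have [uoe|_] := eqVneq u (opp_edge e).
      by move: es'; rewrite -uoe us.
    by rewrite (z0 _ us) subrr mulr0 subrr.
  exists 0; first by split; [exact: linset0|].
  move=> z Az z0; exists 0 => u; rewrite scaler0 subr0 inE => /orP[/eqP->|/z0//].
  have [[z1 zN] _] := (dL _ Az).1.
  have [Ke|nKe] := pselect (edges K e); last exact: z1.
  have [es|es] := boolP (e \in s); first exact: z0.
  have [es'|es'] := boolP (opp_edge e \in s); last by case: ne.
  by apply/eqP; rewrite -oppr_eq0 -zN// z0.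
apply: (closed_range (C := C ^+ 2) hE hV).
- exact: linset_vanishing.
- by move=> z [/dL].
- apply: (closed_vanishing hE hV dL (delta_bar_closed Klocfin Kweights)) => e _.
  have [Ke|nKe] := pselect (edges K e).
    by exists (half_r r e)^-1 => u Lu; exact: (eval_L2E Kweights).
  by exists 0 => u [[u0 _] _]; rewrite u0// normsq0 mul0r.
move=> [phi g] [dphi pv] /=.
have d0 := linset0 (linset_d_bar Klocfin Kweights).
have v0 : vanishing_on (fset_set (vertices K0)) (0 : V -> R[i]) by [].
have := compl_bound d0 dphi v0 pv.
by rewrite (hilbert0 hE) (hilbert0 hV) addr0 add0r.
Qed.

End ClosedRange.

Theorem theorem3 (R : realType) (V : choiceType) (K : graph V)
    (c : V -> R) (r : V * V -> R)
    (Kconnected : connected_graph K) (Klocfin : locally_finite K)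
    (Kweights : weights K c r)
    (Kchi : chi_complete K c r) (Dpos : positive_at_infinity K c r) :
  norm_closed (L2H K c r) (normH K c r) ((D_bar K c r).`2) /\
  orthogonal_sum (innerE K r) (L2E K r)
    (op_ker (delta_bar K c r)) ((d_bar K c r).`2) /\
  orthogonal_sum (innerV K c) (L2V K c)
    (op_ker (d_bar K c r)) ((delta_bar K c r).`2).
Proof.
have [K0 [[K0sub K0fin _] [C [C0 KcC]]]] := Dpos.
have cld := range_d_bar_closed Klocfin Kweights K0sub K0fin C0 KcC.
have cldelta := range_delta_bar_closed Klocfin Kweights K0sub K0fin C0 KcC.
have [hV hE] := (hilbert_L2V Kweights, hilbert_L2E Kweights).
have [sd sdelta] := (linset_d_bar Klocfin Kweights, linset_delta_bar Klocfin Kweights).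
have [dL deltaL] := (d_bar_L2 Klocfin Kweights, delta_bar_L2 Klocfin Kweights).
have linset_range (X Y : lmodType R[i]) (A : set (X * Y)) : linset A -> linset A.`2.
  move=> sA; split; first by exists 0; exact: (linset0 sA).
  move=> a y y' [x xy] [x' xy']; exists (a *: x + x').
  exact: (proj2 sA a _ _ xy xy').
split; last split.
- rewrite /norm_closed (norm_closureE (hilbert_linset (hilbert_prod hV hE))
    (normH_sqrt Kweights) (hilbert_ge0 (hilbert_prod hV hE))); last first.
    move=> [g psi] [[f phi] /(D_barP Klocfin Kweights)[df dphi]].
    by split; [case: (deltaL _ dphi)|case: (dL _ df)].
  (* Each component of a limit of images is adherent to the range of one operator; the preimages
     found separately assemble into a preimage under [D_bar]. *)
  move=> [g psi] [[/= Lg Lpsi] ad].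
  have [|f df] := cld psi.
    split=> // e /ad[[g' psi'] [[f phi] /(D_barP Klocfin Kweights)[df dphi]] le_e].
    exists psi'; first by exists f.
    by apply: le_trans le_e; rewrite /sum_sq lerDr (hilbert_ge0 hV).
  have [|phi dphi] := cldelta g.
    split=> // e /ad[[g' psi'] [[f' phi] /(D_barP Klocfin Kweights)[df' dphi]] le_e].
    exists g'; first by exists phi.
    by apply: le_trans le_e; rewrite /sum_sq lerDl (hilbert_ge0 hE).
  by exists (f, phi); apply/(D_barP Klocfin Kweights).
- split; last by move=> a b; exact: innerE_ker_range.
  apply/seteqP; split=> [phi Lphi|_ [a ka [b [f df] <-]]]; last first.
    apply: (linsetD (hilbert_linset hE)); first by case: (deltaL _ ka).
    by case: (dL _ df).
  have [|b [f df] bmin] := hilbert_projection hE (linset_range _ _ _ sd) _ cld Lphi.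
    by move=> b [f /dL[]].
  have Lphib : L2E K r (phi - b).
    by apply: (linsetB (hilbert_linset hE)) => //; case: (dL _ df).
  exists (phi - b); last by exists b; [exists f|rewrite subrK].
  apply: delta_bar_ker => //; exact: (range_d_perp Klocfin Kweights Lphib).
- split; last by move=> a b; exact: innerV_ker_range.
  apply/seteqP; split=> [g Lg|_ [a ka [b [f df] <-]]]; last first.
    apply: (linsetD (hilbert_linset hV)); first by case: (dL _ ka).
    by case: (deltaL _ df).
  have [|b [phi dphi] bmin] :=
      hilbert_projection hV (linset_range _ _ _ sdelta) _ cldelta Lg.
    by move=> b [f /deltaL[]].
  have Lgb : L2V K c (g - b).
    by apply: (linsetB (hilbert_linset hV)) => //; case: (deltaL _ dphi).
  exists (g - b); last by exists b; [exists phi|rewrite subrK].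
  apply: d_bar_ker => //; exact: (range_delta_perp Klocfin Kweights Lgb).
Qed.
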